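(* Consider the fast-slow system $x'=f(x,y)$, $y'=\frac1\varepsilon g(x,y)$, $(x(0),y(0))=(x_0,y_0)$, with $0<\varepsilon\le\varepsilon_0\ll1$, satisfying the regularity assumption (with integer $K>0$), the rapid dissipation assumption, and the long-time stability assumption (with constant $A$ and maximal stability time $T_\varepsilon$) described in the context. Let $k\ge 0$ be an integer with $k\le K-1$, and let $X_k$ be the solution of the $k$-th order correction model $X_k'=f(X_k,\Gamma_k(X_k,\varepsilon))$. Suppose that $X_k(0)=x(0)$ and that the initial state satisfies $|y(0)-\Gamma_k(x(0),\varepsilon)|=\mathcal O(\varepsilon^{k+1})$ (i.e. it is at most a constant independent of $\varepsilon$ times $\varepsilon^{k+1}$). Then there exists a constant $C>0$ independent of $\varepsilon$, $t$ and $A$ such that $$|x(t)-X_k(t)|\le C A\,\varepsilon^{k+1}(t+1)\qquad\text{for each } t\in[0,T_\varepsilon].$$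
   Context: Setting. $x(t)\in\mathbb R^{n_x}$ and $y(t)\in\mathbb R^{n_y}$ are the slow and fast variables of the system $x'=f(x,y)$, $y'=\frac1\varepsilon g(x,y)$, $x(0)=x_0$, $y(0)=y_0$, where $0<\varepsilon\le\varepsilon_0\ll 1$; the functions $f,g$ do not depend on $\varepsilon$. Regularity assumption: $f,g$ are sufficiently smooth, and for some integer $K>0$, $f\in W^{K,\infty}(\mathbb R^{n_x}\times\mathbb R^{n_y},\mathbb R^{n_x})$ and $\nabla g\in W^{K,\infty}(\mathbb R^{n_x}\times\mathbb R^{n_y},\mathbb R^{n_y\times(n_x+n_y)})$. Rapid dissipation assumption: there is $\beta>0$ such that $\langle g(x,y)-g(x,\tilde y),y-\tilde y\rangle\le-\beta|y-\tilde y|^2$ for all $x\in\mathbb R^{n_x}$, $y,\tilde y\in\mathbb R^{n_y}$. Under these assumptions $g(x,\cdot):\mathbb R^{n_y}\to\mathbb R^{n_y}$ is bijective for each $x$; $\gamma(x)$ denotes the unique point with $g(x,\gamma(x))=0$. Long-time stability assumption: let $\Phi_t^\varepsilon(x_0,y_0)=(x(t),y(t))$ be the flow map of the full system. There are a constant $A>0$, independent of $\varepsilon$ and $t$, and a time $T_\varepsilon$ (the maximal stability time) such that $\|\nabla\Phi_t^\varepsilon\|_{L^\infty}\le A$ for each $t\in[0,T_\varepsilon]$, where $\nabla$ is the Jacobian with respect to $(x_0,y_0)$ and the supremum is over all of $\mathbb R^{n_x}\times\mathbb R^{n_y}$. Correction models: $\Gamma_0(x,\varepsilon)=\gamma(x)$,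 and $\Gamma_{k+1}(x,\varepsilon)$ is defined recursively as the unique solution of $g(x,\Gamma_{k+1}(x,\varepsilon))=\varepsilon\,\nabla_x\Gamma_k(x,\varepsilon)\cdot f(x,\Gamma_k(x,\varepsilon))$. The $k$-th order correction model is $X_k'=f(X_k,\Gamma_k(X_k,\varepsilon))$. *)

(* Defs.v *)
From HB Require Import structures.
From mathcomp Require Import all_boot all_order all_algebra.
From mathcomp Require Import all_classical all_reals all_analysis.
Set Implicit Arguments.
Unset Strict Implicit.
Unset Printing Implicit Defensive.
Import Order.TTheory GRing.Theory Num.Theory.
Import numFieldNormedType.Exports.
Local Open Scope classical_set_scope.
Local Open Scope ring_scope.

(* Euclidean structure on R^n and on R^n x R^m.  The canonical norm of the
   library on these spaces is the sup norm, which is used below only for the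
   topology, differentiability and boundedness. *)
Definition dotv (R : realType) (n : nat) (u v : 'rV[R]_n) : R :=
  \sum_(i < n) u 0 i * v 0 i.

Definition enorm (R : realType) (n : nat) (u : 'rV[R]_n) : R :=
  Num.sqrt (dotv u u).

Definition enorm2 (R : realType) (n m : nat) (z : 'rV[R]_n * 'rV[R]_m) : R :=
  Num.sqrt (enorm z.1 ^+ 2 + enorm z.2 ^+ 2).

(* [iterD [:: v1; ...; vj] F] is the iterated directional derivative
   D_v1 (... (D_vj F)). *)
Definition iterD (R : realType) (V W : normedModType R) (vs : seq V)
    (F : V -> W) : V -> W :=
  foldr (fun (v : V) (G : V -> W) (z : V) => 'D_v G z) F vs.

Definition smooth (R : realType) (V W : normedModType R) (n : nat)
    (F : V -> W) : Prop :=
  (forall vs : seq V, (size vs < n)%N ->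
     forall z : V, differentiable (iterD vs F) z) /\
  (forall vs : seq V, (size vs <= n)%N -> continuous (iterD vs F)).

(* Membership in W^{n,oo} for functions of class C^n: weak derivatives are then
   classical ones.  On a finite-dimensional space, bounding the derivatives
   along each fixed tuple of directions bounds all partial derivatives. *)
Definition Winfty (R : realType) (V W : normedModType R) (n : nat)
    (F : V -> W) : Prop :=
  forall vs : seq V, (size vs <= n)%N ->
    exists M : R, forall z : V, `|iterD vs F z| <= M.

(* The condition on the gradient of g is expressed through its columns, the
   directional derivatives of g; g itself may be unbounded. *)
Definition regularity (R : realType) (nx ny K : nat)
    (f : 'rV[R]_nx * 'rV[R]_ny -> 'rV[R]_nx)
    (g : 'rV[R]_nx * 'rV[R]_ny -> 'rV[R]_ny) : Prop :=
  [/\ smooth K f, Winfty K f, smooth K.+1 g &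
      forall v : 'rV[R]_nx * 'rV[R]_ny, Winfty K (fun z => 'D_v g z)].

Definition rapid_dissipation (R : realType) (nx ny : nat)
    (g : 'rV[R]_nx * 'rV[R]_ny -> 'rV[R]_ny) (beta : R) : Prop :=
  forall (x : 'rV[R]_nx) (y y' : 'rV[R]_ny),
    dotv (g (x, y) - g (x, y')) (y - y') <= - beta * enorm (y - y') ^+ 2.

(* [z] solves z' = F z on [0, +oo[ with z 0 = z0; the values of [z] at negative
   times are irrelevant. *)
Definition is_solution (R : realType) (V : normedModType R) (F : V -> V)
    (z0 : V) (z : R -> V) : Prop :=
  [/\ z 0 = z0, z t @[t --> 0^'+] --> z 0 &
      forall t : R, 0 < t -> is_derive t 1 z (F (z t))].

Definition full_field (R : realType) (nx ny : nat)
    (f : 'rV[R]_nx * 'rV[R]_ny -> 'rV[R]_nx)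
    (g : 'rV[R]_nx * 'rV[R]_ny -> 'rV[R]_ny) (eps : R)
    (z : 'rV[R]_nx * 'rV[R]_ny) : 'rV[R]_nx * 'rV[R]_ny :=
  (f z, eps^-1 *: g z).

Definition is_flow_map (R : realType) (V : normedModType R) (F : V -> V)
    (Phi : R -> V -> V) : Prop :=
  forall z0 : V, is_solution F z0 (fun t => Phi t z0).

(* The Jacobian is measured in the operator norm induced by the Euclidean norm.
   [T eps] may be infinite. *)
Definition long_time_stability (R : realType) (nx ny : nat) (eps0 : R)
    (Phi : R -> R -> 'rV[R]_nx * 'rV[R]_ny -> 'rV[R]_nx * 'rV[R]_ny)
    (A : R) (T : R -> \bar R) : Prop :=
  forall eps t : R, 0 < eps <= eps0 -> 0 <= t -> (t%:E <= T eps)%E ->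
  forall z : 'rV[R]_nx * 'rV[R]_ny,
    differentiable (Phi eps t) z /\
    forall v : 'rV[R]_nx * 'rV[R]_ny,
      enorm2 ('d (Phi eps t) z v) <= A * enorm2 v.

(* [solve_y g x w] is the solution y of g (x, y) = w.  It exists and is unique
   when g is smooth and rapidly dissipative; [xget] is a choice operator with
   the default value 0. *)
Definition solve_y (R : realType) (nx ny : nat)
    (g : 'rV[R]_nx * 'rV[R]_ny -> 'rV[R]_ny)
    (x : 'rV[R]_nx) (w : 'rV[R]_ny) : 'rV[R]_ny :=
  xget 0 [set y | g (x, y) = w].

Fixpoint Gamma (R : realType) (nx ny : nat)
    (f : 'rV[R]_nx * 'rV[R]_ny -> 'rV[R]_nx)
    (g : 'rV[R]_nx * 'rV[R]_ny -> 'rV[R]_ny) (k : nat) (eps : R)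
    (x : 'rV[R]_nx) : 'rV[R]_ny :=
  if k is j.+1 then
    solve_y g x
      (eps *: 'd (Gamma f g j eps) x (f (x, Gamma f g j eps x)))
  else solve_y g x 0.

Definition correction_field (R : realType) (nx ny : nat)
    (f : 'rV[R]_nx * 'rV[R]_ny -> 'rV[R]_nx)
    (g : 'rV[R]_nx * 'rV[R]_ny -> 'rV[R]_ny) (k : nat) (eps : R)
    (x : 'rV[R]_nx) : 'rV[R]_nx :=
  f (x, Gamma f g k eps x).

(* Main.v *)
(* Lift the reduced trajectory to [W t = (X_k t, Gamma_(k+1) (X_k t))].  Since
   [g (x, Gamma_(k+1) x) = eps *: D Gamma_k x (f (x, Gamma_k x))], [W] solves the
   full system up to [f (x, Gamma_k x) - f (x, Gamma_(k+1) x)] in the slow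
   component and [D (Gamma_(k+1) - Gamma_k) x (f (x, Gamma_k x))] in the fast one.
   Both are [O(eps ^+ k.+1)] because [Gamma_(j+1) - Gamma_j] is [O(eps ^+ j.+1)]
   with its derivatives of order at most [K - j], by induction on [j]: subtract
   the equations defining [Gamma_(j+1)] and [Gamma_j] and invert the y-derivative
   of [g], which dissipativity makes uniformly coercive.  The flow of the full
   system is [A]-Lipschitz up to time [T eps], so transporting the defects
   committed by [W] on small time steps to the final time costs a factor [A]
   only. *)
Require Import Defs.
From HB Require Import structures.
From mathcomp Require Import all_boot all_order all_algebra.
From mathcomp Require Import all_classical all_reals all_analysis.
From mathcomp Require Import ring lra.
Import Order.TTheory GRing.Theory Num.Theory.
Import numFieldNormedType.Exports.
Local Open Scope classical_set_scope.
Local Open Scope ring_scope.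
Set Implicit Arguments.
Unset Strict Implicit.
Unset Printing Implicit Defensive.

(** * The Euclidean norm and Gronwall's inequality *)

(** Gronwall's inequality over the whole interval is useless here: the available Lipschitz constant
    [L] of the full field grows like [eps^-1]. Its exponential is therefore used only on steps [d]
    with [L * d <= 1], and growth over longer times is left to [A]. The second concern is uniformity
    in [eps]. All maps are treated as families indexed by the admissible [eps], with each derivative
    along fixed directions bounded by a gauge such as a power of [eps]. Since [g] may be unbounded,
    so may [Gamma_0], whence a separate class that controls gradients only. The recursion for
    [Gamma] differentiates the previous map, so each correction costs one derivative and gains one
    power of [eps]. The defect of [W] needs one derivative of [Gamma_(k+1) - Gamma_k]; this is what
    [k <= K - 1] leaves available. *)

Section Euclid.
Context {R : realType} {n : nat}.
Implicit Types u v w : 'rV[R]_n.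

Lemma dotvC u v : dotv u v = dotv v u.
Proof. by apply: eq_bigr => i _; rewrite mulrC. Qed.

Lemma dotvDl u v w : dotv (u + v) w = dotv u w + dotv v w.
Proof. by rewrite -big_split; apply: eq_bigr => i _; rewrite mxE mulrDl. Qed.

Lemma dotvZl a u v : dotv (a *: u) v = a * dotv u v.
Proof. by rewrite mulr_sumr; apply: eq_bigr => i _; rewrite mxE mulrA. Qed.

Lemma dotvNl u v : dotv (- u) v = - dotv u v.
Proof. by rewrite -scaleN1r dotvZl mulN1r. Qed.

Lemma dotvBl u v w : dotv (u - v) w = dotv u w - dotv v w.
Proof. by rewrite dotvDl dotvNl. Qed.

Lemma dotvBr u v w : dotv w (u - v) = dotv w u - dotv w v.
Proof. by rewrite dotvC dotvBl !(dotvC w). Qed.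

Lemma dotvZr a u v : dotv u (a *: v) = a * dotv u v.
Proof. by rewrite dotvC dotvZl dotvC. Qed.

Lemma dotvv_ge0 u : 0 <= dotv u u.
Proof. by apply: sumr_ge0 => i _; rewrite -expr2 sqr_ge0. Qed.

Lemma enorm_ge0 u : 0 <= enorm u.
Proof. exact: sqrtr_ge0. Qed.

Lemma sqr_enorm u : enorm u ^+ 2 = dotv u u.
Proof. by rewrite sqr_sqrtr // dotvv_ge0. Qed.

Lemma enormN u : enorm (- u) = enorm u.
Proof. by rewrite /enorm dotvNl dotvC dotvNl opprK. Qed.

Lemma enormZ a u : enorm (a *: u) = `|a| * enorm u.
Proof.
by rewrite /enorm dotvZl dotvZr mulrA -expr2 sqrtrM ?sqr_ge0 // sqrtr_sqr.
Qed.

Lemma enorm0 : enorm (0 : 'rV[R]_n) = 0.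
Proof. by rewrite -(scale0r 0) enormZ normr0 mul0r. Qed.

Lemma normr_le_enorm u : `|u| <= enorm u.
Proof.
rewrite [leLHS]mx_normrE; apply: bigmax_le; first exact: enorm_ge0.
move=> [i j] _ /=; rewrite (ord1 i) -sqrtr_sqr ler_sqrt ?dotvv_ge0 //.
rewrite /dotv (bigD1 j) //= -expr2 lerDl.
by apply: sumr_ge0 => l _; rewrite -expr2 sqr_ge0.
Qed.

Lemma enorm0_eq0 u : enorm u = 0 -> u = 0.
Proof.
by move=> u0; apply/normr0_eq0/le_anti; rewrite normr_ge0 -u0 normr_le_enorm.
Qed.

Lemma cauchy_schwarz u v : dotv u v <= enorm u * enorm v.
Proof.
have [/enorm0_eq0 ->|v0] := eqVneq (enorm v) 0.
  have d0 : dotv u 0 = 0 by apply: big1 => i _; rewrite mxE mulr0.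
  by rewrite d0 mulr_ge0 ?enorm_ge0.
have vgt : 0 < enorm v by rewrite lt_neqAle eq_sym v0 enorm_ge0.
(* This square equals [enorm v ^+ 2] times the gap between the two sides of the squared
   inequality. *)
have := dotvv_ge0 (dotv v v *: u - dotv u v *: v).
rewrite !(dotvBl, dotvBr, dotvZl, dotvZr) (dotvC v u) -!sqr_enorm => h.
have h2 : dotv u v ^+ 2 <= (enorm u * enorm v) ^+ 2.
  rewrite -(@ler_pM2l _ (enorm v ^+ 2)) ?exprn_gt0 // -subr_ge0.
  by move: h; congr (0 <= _); ring.
apply: le_trans (ler_norm _) _.
rewrite -[leRHS]ger0_norm ?mulr_ge0 ?enorm_ge0 //.
by rewrite -ler_sqr ?nnegrE ?normr_ge0 // !real_normK ?num_real.
Qed.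

Lemma enormD u v : enorm (u + v) <= enorm u + enorm v.
Proof.
rewrite -ler_sqr ?nnegrE ?addr_ge0 ?enorm_ge0 //.
rewrite sqr_enorm dotvDl !(dotvC _ (u + v)) !dotvDl -!sqr_enorm (dotvC v u).
have := cauchy_schwarz u v; rewrite !expr2; nra.
Qed.

Lemma ler_coord_normr u i : `|u 0 i| <= `|u|.
Proof. by rewrite [leRHS]mx_normrE; exact: (le_bigmax _ _ (0, i)). Qed.

Lemma enorm_le_normr u : enorm u <= n%:R * `|u|.
Proof.
rewrite -ler_sqr ?nnegrE ?mulr_ge0 ?enorm_ge0 ?normr_ge0 // sqr_enorm.
have h : dotv u u <= \sum_(i < n) `|u| ^+ 2.
  apply: ler_sum => i _; rewrite -expr2 -real_normK ?num_real //.
  by rewrite ler_sqr ?nnegrE // ler_coord_normr.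
apply: le_trans h _; rewrite sumr_const card_ord exprMn -[X in X <= _]mulr_natl.
apply: ler_wpM2r; first exact: sqr_ge0.
by rewrite -natrX ler_nat; case: (n) => // p; rewrite leq_pmull.
Qed.

End Euclid.

(** * Derivatives along curves *)

Section Curves.
Context {R : realType}.

Lemma is_derive_coord m n (e : R -> 'M[R]_(m, n)) (t : R) d i j :
  is_derive t 1 e d -> is_derive t 1 (fun s => e s i j) (d i j).
Proof.
move=> [de <-]; rewrite (derive_mx de) mxE.
by apply: derivableP; move/derivable_mxP: de.
Qed.

Lemma differentiable_dotvv n (u : 'rV[R]_n) :
  differentiable (fun v : 'rV[R]_n => dotv v v) u.
Proof.
have -> : (fun v => dotv v v) =
   \sum_(i < n) ((fun v : 'rV[R]_n => v 0 i : R) * (fun v => v 0 i)).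
  by rewrite fct_sumE.
apply: differentiable_sum => i.
by apply: differentiableM; exact: differentiable_coord.
Qed.

Lemma is_derive_dotvv n (e : R -> 'rV[R]_n) (t : R) d : is_derive t 1 e d ->
  is_derive t 1 (fun s => dotv (e s) (e s)) (2 * dotv (e t) d).
Proof.
move=> ed; have c i := is_derive_coord 0 i ed.
have -> : (fun s => dotv (e s) (e s)) =
   \sum_(i < n) ((fun s => e s 0 i) * (fun s => e s 0 i)).
  by rewrite fct_sumE.
apply: is_derive_eq.
rewrite mulr_sumr; apply: eq_bigr => i _.
rewrite -[LHS]/(e t 0 i * d 0 i + e t 0 i * d 0 i); ring.
Qed.

(* Gronwall's inequality for [enorm (e t)], applied to the differentiable
   substitute [sqrt (enorm (e t) ^+ 2 + k ^+ 2)] with [k] tending to 0. *)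
Lemma gronwall n (e : R -> 'rV[R]_n) (L c : R) : 0 <= L -> 0 <= c ->
  e t @[t --> 0^'+] --> e 0 ->
  (forall t : R, 0 < t -> exists2 d, is_derive t 1 e d &
     dotv (e t) d <= L * enorm (e t) ^+ 2 + c * enorm (e t)) ->
  forall t : R, 0 <= t -> enorm (e t) <= expR (L * t) * (enorm (e 0) + c * t).
Proof.
move=> L0 c0 e0 de t; rewrite le_eqVlt => /orP[/eqP <-|t0].
  by rewrite !mulr0 expR0 mul1r addr0.
suff H (k : R) : 0 < k -> enorm (e t) <= expR (L * t) * (enorm (e 0) + k + c * t).
  (* The parameter is divided by [expR (L * t)], so that the excess left in the bound is exactly
     [k]. *)
  apply/ler_addgt0Pr => k k0.
  have E0 := expR_gt0 (L * t).
  have := H (k / expR (L * t)); rewrite divr_gt0 // => /(_ isT).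
  move=> /le_trans; apply.
  rewrite -addrA (addrC (k / _)) addrA mulrDr lerD2l mulrC divfK //.
  by rewrite gt_eqF.
move=> k0.
pose q (s : R) : R := dotv (e s) (e s) + k ^+ 2.
have q0 s : 0 < q s by rewrite ltr_wpDl ?dotvv_ge0 ?exprn_gt0.
(* Integrating factor: [P] is nonincreasing, because the derivative of [Num.sqrt (q s)] is at most
   [L * Num.sqrt (q s) + c] and [expR (- L * s) <= 1] lets [c * s] absorb the forcing term. *)
pose P (s : R) : R := Num.sqrt (q s) * expR (- L * s) - c * s.
have dP (s : R) : 0 < s -> exists2 d, is_derive s 1 P d & d <= 0.
  move=> s0; have [d ed dle] := de s s0.
  have dq : is_derive s 1 q (2 * dotv (e s) d).
    have := is_derive_dotvv ed => ?.
    rewrite /q; apply: is_derive_eq; exact: addr0.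
  have ds := is_derive1_comp (is_derive1_sqrt (q0 s)) dq.
  have dx : is_derive s 1 (fun s => expR (- L * s)) (expR (- L * s) * - L).
    have dl : is_derive s 1 (fun s : R => - L * s) (- L).
      have -> : (fun s : R => - L * s) = (- L) \*: id by [].
      apply: is_derive_eq; exact: mulr1.
    exact: (is_derive1_comp (is_derive_expR _) dl).
  have dc : is_derive s 1 (fun s => c * s) c.
    have -> : (fun s : R => c * s) = c \*: id by [].
    apply: is_derive_eq; exact: mulr1.
  exists (Num.sqrt (q s) * (expR (- L * s) * - L) +
      expR (- L * s) * ((2 * Num.sqrt (q s))^-1 * (2 * dotv (e s) d)) - c).
    exact: (is_deriveB (is_deriveM ds dx) dc).
  set S := Num.sqrt (q s); set E := expR _.
  have Sgt : 0 < S by rewrite sqrtr_gt0.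
  have SS : S ^+ 2 = q s by rewrite sqr_sqrtr // ltW.
  have Sle : enorm (e s) <= S.
    by rewrite -ler_sqr ?nnegrE ?enorm_ge0 ?(ltW Sgt)// SS sqr_enorm lerDl sqr_ge0.
  have E1 : E <= 1.
    by rewrite -expR0 ler_expR; rewrite mulNr oppr_le0 mulr_ge0 // ltW.
  have E0 : 0 < E by exact: expR_gt0.
  have en0 := enorm_ge0 (e s).
  have h1 : dotv (e s) d <= L * S ^+ 2 + c * S.
    apply: le_trans dle _; apply: lerD; apply: ler_wpM2l => //.
    by rewrite ler_sqr ?nnegrE ?(ltW Sgt).
  have h2 : (2 * S)^-1 * (2 * dotv (e s) d) <= L * S + c.
    have -> : (2 * S)^-1 * (2 * dotv (e s) d) = S^-1 * dotv (e s) d.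
      by field; rewrite gt_eqF.
    by rewrite ler_pdivrMl //; move: h1; rewrite expr2; nra.
  have : E * ((2 * S)^-1 * (2 * dotv (e s) d)) <= E * (L * S + c).
    by rewrite ler_pM2l.
  move: E0 E1 c0; nra.
have cP : {within `[0, t], continuous P}.
  apply/(continuous_within_itvP _ t0).
  have cs (s : R) : 0 < s -> {for s, continuous P}.
    move=> /dP [d [Pd _] _].
    by apply/differentiable_continuous/derivable1_diffP.
  split.
  - by move=> s; rewrite in_itv /= => /andP[s0 _]; exact: cs.
  - have cq : q s @[s --> 0^'+] --> q 0.
      apply: cvgD; last exact: cvg_cst.
      have ce : {for e 0, continuous (fun v : 'rV[R]_n => dotv v v)}.
        exact/differentiable_continuous/differentiable_dotvv.
      exact: (continuous_cvg _ ce e0).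
    have lin (a : R) : a * s @[s --> 0^'+] --> a * 0.
      by apply: cvgM; [exact: cvg_cst|exact: cvg_at_right_filter].
    have cS : Num.sqrt (q s) @[s --> 0^'+] --> Num.sqrt (q 0).
      exact: (continuous_cvg _ (@sqrt_continuous R _) cq).
    have cE : expR (- L * s) @[s --> 0^'+] --> expR (- L * 0).
      exact: (continuous_cvg _ (@continuous_expR R _) (lin _)).
    exact: (cvgB (cvgM cS cE) (lin c)).
  - exact/cvg_at_left_filter/cs.
have PP : P t <= P 0.
  apply: (ler0_derive1_nincr _ _ cP); rewrite ?lexx ?(ltW t0) //.
  - by move=> s; rewrite in_itv /= => /andP[s0 _]; have [d [? _] _] := dP s s0.
  - move=> s; rewrite in_itv /= => /andP[s0 _]; have [d [? <-] ?] := dP s s0.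
    by rewrite derive1E.
have q0le : Num.sqrt (q 0) <= enorm (e 0) + k.
  rewrite -ler_sqr ?nnegrE ?sqrtr_ge0 ?addr_ge0 ?enorm_ge0 ?(ltW k0) //.
  rewrite sqr_sqrtr ?(ltW (q0 _)) // /q -sqr_enorm.
  by rewrite sqrrD lerD2r lerDl mulrn_wge0 // mulr_ge0 ?enorm_ge0 // ltW.
have qtge : enorm (e t) <= Num.sqrt (q t).
  rewrite -ler_sqr ?nnegrE ?sqrtr_ge0 ?enorm_ge0 //.
  by rewrite sqr_enorm sqr_sqrtr ?(ltW (q0 _)) // lerDl sqr_ge0.
apply: (le_trans qtge).
rewrite -ler_pdivrMl ?expR_gt0 // -expRN -mulNr mulrC.
move: PP; rewrite /P !mulr0 expR0 mulr1 subr0. 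
by move: q0le; lra.
Qed.
End Curves.

(** * Differentiability of implicit functions *)

Section Dissipative.
Context {R : realType} {n : nat}.
Variable beta : R.
Hypothesis beta_gt0 : 0 < beta.

(** Cauchy-Schwarz followed by division by [enorm d]. It inverts both the nonlinear equation, with
    [w] a difference of values of [g], and its linearization in the fast variable. *)
Lemma dissipative_bound (d w : 'rV[R]_n) :
  dotv w d <= - beta * enorm d ^+ 2 -> enorm d <= beta^-1 * enorm w.
Proof.
move=> h; have [->|d0] := eqVneq (enorm d) 0.
  by rewrite mulr_ge0 ?enorm_ge0 // invr_ge0 ltW.
have dgt : 0 < enorm d by rewrite lt_neqAle eq_sym d0 enorm_ge0.
rewrite ler_pdivlMl // -(ler_pM2r dgt).
have := cauchy_schwarz (- w) d; rewrite dotvNl enormN.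
apply: le_trans; rewrite lerNr; apply: le_trans h _.
by rewrite expr2 mulNr mulrA.
Qed.

Lemma coercive_unitmx (J : 'M[R]_n) :
  (forall d, dotv (d *m J) d <= - beta * enorm d ^+ 2) -> J \in unitmx.
Proof.
move=> cJ; rewrite -row_free_unit; apply: inj_row_free => v vJ.
apply: enorm0_eq0; apply: le_anti; rewrite enorm_ge0 andbT.
have := dissipative_bound (cJ v); rewrite vJ => /le_trans; apply.
by rewrite enorm0 mulr0.
Qed.

End Dissipative.

Section DiffTools.
Context {R : realType}.

Lemma is_derive_comp_curve (V W : normedModType R) (h : V -> W) (c : R -> V)
    (t : R) d : is_derive t 1 c d -> differentiable h (c t) ->
  is_derive t 1 (h \o c) ('d h (c t) d).
Proof.
move=> [dc <-] dh; have dct := (derivable1_diffP _ _).1 dc.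
have dhc := differentiable_comp dct dh.
split; first exact/derivable1_diffP.
by rewrite !deriveE // diff_comp.
Qed.

Lemma is_derive_segment (V W : normedModType R) (h : V -> W) (a v : V) (s : R) :
  differentiable h (a + s *: v) ->
  is_derive s 1 (fun s => h (a + s *: v)) ('d h (a + s *: v) v).
Proof.
move=> dh; apply: (@is_derive_comp_curve _ _ h (fun s => a + s *: v)) => //.
have ds : is_derive s 1 (fun s : R => s *: v) v.
  have e : (fun s : R => s *: v) = *:%R ^~ v by [].
  have dv : differentiable (fun s : R => s *: v) s by exact: ex_diff.
  split; first exact/derivable1_diffP.
  by rewrite deriveE // diff_val scale1r.
by apply: is_derive_eq; exact: add0r.
Qed.

(** The sup norm reduces the inequality to the scalar mean value theorem in each coordinate. Only
    the direction [a - b] is tested, so a vertical displacement involves vertical derivatives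
    only. *)
Lemma mean_value_bound (V : normedModType R) p (h : V -> 'rV[R]_p) (L : R) a b :
  (forall z, differentiable h z) -> (forall z, `|'d h z (a - b)| <= L) ->
  `|h a - h b| <= L.
Proof.
move=> dh hL; have L0 : 0 <= L by exact: le_trans (normr_ge0 _) (hL a).
rewrite [leLHS]mx_normrE; apply: bigmax_le => // -[i j] _ /=.
rewrite (ord1 i) {i} !mxE.
pose c s := b + s *: (a - b).
have dc (s : R) : is_derive s 1 (fun s => h (c s) 0 j) ('d h (c s) (a - b) 0 j).
  by apply: is_derive_coord; exact: is_derive_segment.
have [|s _] := @MVT _ (fun s => h (c s) 0 j)
   (fun s => 'd h (c s) (a - b) 0 j) 0 1 ltr01 (fun s _ => dc s).
  apply: continuous_subspaceT => s.
  by apply/differentiable_continuous/derivable1_diffP; have [] := dc s.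
rewrite /c scale1r scale0r addr0 subr0 mulr1 subrKC => ->.
exact: le_trans (ler_coord_normr _ _) (hL (c s)).
Qed.

Lemma differentiable_expansion (V W : normedModType R) (f : V -> W) (x : V) :
  differentiable f x -> forall e, 0 < e ->
  exists2 r : R, 0 < r & forall h, `|h| < r ->
    `|f (h + x) - f x - 'd f x h| <= e * `|h|.
Proof.
move=> /diff_locally/eqaddoP dfx e e0.
have /nbhs_ballP[r /= r0 rP] := dfx e e0.
exists r => // h hr; have := rP h; rewrite -ball_normE /= sub0r normrN.
move=> /(_ hr); rewrite !fctE /= opprD addrA.
by [].
Qed.

(** The bound [C] supplies continuity of the candidate derivative, which linearity alone does not
    give on an arbitrary normed space. *)
Lemma differentiable_of_expansion (V W : normedModType R) (f : V -> W)
    (df : {linear V -> W}) (x : V) (C : R) :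
  (forall v, `|df v| <= C * `|v|) ->
  (forall e, 0 < e -> exists2 r : R, 0 < r & forall h, `|h| < r ->
     `|f (h + x) - f x - df h| <= e * `|h|) ->
  differentiable f x.
Proof.
move=> dfC hf.
have cdf : continuous df.
  apply: bounded_linear_continuous.
  apply/ex_bound; exists `|C|; apply/nbhs_ballP; exists 1 => //= v.
  rewrite -ball_normE /= sub0r normrN => v1; apply: le_trans (dfC v) _.
  apply: (@le_trans _ _ (`|C| * `|v|)).
    by rewrite ler_wpM2r ?normr_ge0 // ler_norm.
  by rewrite ler_piMr // ltW.
have exp : f \o shift x = cst (f x) + df +o_ 0 id.
  apply/eqaddoP => e e0; have [r r0 rP] := hf e e0.
  apply/nbhs_ballP; exists r => //= h; rewrite -ball_normE /= sub0r normrN.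
  by move=> /rP; rewrite !fctE /= opprD addrA.
by apply/diff_locallyP; rewrite (diff_unique cdf exp).
Qed.

Lemma normr_pair0l (V W : normedModType R) (v : V) : `|(v, 0 : W)| = `|v|.
Proof. by rewrite prod_normE /= normr0 max_l. Qed.

Lemma normr_pair0r (V W : normedModType R) (w : W) : `|(0 : V, w)| = `|w|.
Proof. by rewrite prod_normE /= normr0 max_r. Qed.

Lemma pair0rE (V : normedModType R) n (d : 'rV[R]_n) :
  (0 : V, d) = \sum_(l < n) d 0 l *: (0 : V, delta_mx 0 l : 'rV[R]_n).
Proof.
rewrite [RHS]surjective_pairing !raddf_sum; congr pair.
  by rewrite big1 // => j _ /=; rewrite scaler0.
by rewrite [LHS]row_sum_delta; apply: eq_bigr.
Qed.

Lemma pair0lE (W : normedModType R) n (d : 'rV[R]_n) :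
  (d, 0 : W) = \sum_(l < n) d 0 l *: (delta_mx 0 l : 'rV[R]_n, 0 : W).
Proof.
rewrite [RHS]surjective_pairing !raddf_sum; congr pair.
  by rewrite [LHS]row_sum_delta; apply: eq_bigr.
by rewrite big1 // => j _ /=; rewrite scaler0.
Qed.

Lemma diff_lincomb (V W : normedModType R) n (h : V -> W) (c : 'I_n -> R)
    (e : 'I_n -> V) z : differentiable h z ->
  'd h z (\sum_(l < n) c l *: e l) = \sum_(l < n) c l *: 'D_(e l) h z.
Proof.
move=> dh; rewrite raddf_sum; apply: eq_bigr => l _.
by rewrite (deriveE _ dh) -linearZ.
Qed.

Lemma differentiable_fst (V W : normedModType R) (z : V * W) :
  differentiable (@Datatypes.fst V W) z.
Proof.
apply: (@linear_differentiable _ _ _ (@Datatypes.fst V W)) => p.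
exact: cvg_fst.
Qed.

Lemma differentiable_snd (V W : normedModType R) (z : V * W) :
  differentiable (@Datatypes.snd V W) z.
Proof.
apply: (@linear_differentiable _ _ _ (@Datatypes.snd V W)) => p.
exact: cvg_snd.
Qed.

Section Implicit.
Variables (V : normedModType R) (n : nat) (G : V * 'rV[R]_n -> 'rV[R]_n).
Variable beta : R.
Hypothesis beta_gt0 : 0 < beta.
Hypothesis Gdiss : forall x y y',
  dotv (G (x, y) - G (x, y')) (y - y') <= - beta * enorm (y - y') ^+ 2.

Lemma dissipative_lipschitz x y y' :
  `|y - y'| <= beta^-1 * n%:R * `|G (x, y) - G (x, y')|.
Proof.
apply: le_trans (normr_le_enorm _) _.
apply: (le_trans (dissipative_bound beta_gt0 (Gdiss x y y'))).
by rewrite -mulrA ler_wpM2l ?invr_ge0 ?(ltW beta_gt0) ?enorm_le_normr.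
Qed.

(** Dissipativity for the increment [s *: d], divided by [s ^+ 2], is the claim up to the remainder
    of the expansion of [G]. Instead of a limit in [s], one small [s] is fixed for each tolerance
    [e]; [c] collects the factors from passing between the two norms. *)
Lemma dissipative_diff_coercive x y d : differentiable G (x, y) ->
  dotv ('d G (x, y) (0, d)) d <= - beta * enorm d ^+ 2.
Proof.
move=> dG; apply/ler_addgt0Pr => e e0.
pose c := n%:R * `|d| * enorm d + 1.
have c0 : 0 < c by rewrite ltr_wpDl ?mulr_ge0 ?ler0n ?enorm_ge0.
have [r r0 rP] := differentiable_expansion dG (divr_gt0 e0 c0).
pose s := r / (`|d| + 1).
have d10 : 0 < `|d| + 1 by rewrite ltr_wpDl.
have s0 : 0 < s by rewrite divr_gt0.
have sd : `|(0 : V, s *: d)| < r.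
  rewrite normr_pair0r normrZ gtr0_norm // /s mulrAC ltr_pdivrMr //.
  by rewrite ltr_pM2l // ltrDl.
have := rP _ sd; set D := 'd G _ _; rewrite normr_pair0r.
have -> : D = s *: 'd G (x, y) (0, d).
  by rewrite /D -linearZ /= -[X in _ = 'd G _ X]/(s *: 0, s *: d) scaler0.
have -> : (0 : V, s *: d) + (x, y) = (x, s *: d + y).
  by rewrite -[LHS]/(0 + x, s *: d + y) add0r.
move=> eb; have := Gdiss x (s *: d + y) y; rewrite addrK.
set g := G _ - G _ in eb *; set E := 'd G _ _ in eb *.
rewrite dotvZr enormZ gtr0_norm // exprMn => gd.
have h1 : dotv (s *: E - g) d <= s * e.
  apply: le_trans (cauchy_schwarz _ _) _.
  apply: (@le_trans _ _ (n%:R * (e / c * (s * `|d|)) * enorm d)).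
    rewrite ler_wpM2r ?enorm_ge0 //.
    apply: le_trans (enorm_le_normr _) _; rewrite ler_wpM2l ?ler0n //.
    by rewrite distrC; apply: le_trans eb _; rewrite normrZ gtr0_norm.
  have -> : n%:R * (e / c * (s * `|d|)) * enorm d =
      s * e * ((n%:R * `|d| * enorm d) / c) by field; rewrite gt_eqF.
  apply: ler_piMr; first by rewrite mulr_ge0 // ltW.
  by rewrite ler_pdivrMr // mul1r /c lerDl.
move: h1; rewrite dotvBl dotvZl => h1.
rewrite -(ler_pM2l s0); apply: (@le_trans _ _ (dotv g d + s * e)).
  by rewrite -lerBlDl.
rewrite mulrDr lerD2r -(ler_pM2l s0); apply: le_trans gd _.
by apply/eqP/eqP; rewrite le_eqVlt; apply/orP; left; apply/eqP; ring.
Qed.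

(* At [(x + h, u x + l h)], with [l] the derivative predicted by the implicit
   function theorem, [G] is [o(h)], and dissipativity turns this into
   [u (x + h) = u x + l h + o(h)]. *)
Lemma implicit_differentiable (u : V -> 'rV[R]_n) x :
  (forall x, G (x, u x) = 0) -> differentiable G (x, u x) ->
  differentiable u x.
Proof.
move=> Gu dG.
pose J : 'M[R]_n := \matrix_(i < n) 'D_(0, delta_mx 0 i) G (x, u x).
have JE d : d *m J = 'd G (x, u x) (0, d).
  rewrite pair0rE diff_lincomb // mulmx_sum_row.
  by apply: eq_bigr => j _; rewrite rowK.
have cJ d : dotv (d *m J) d <= - beta * enorm d ^+ 2.
  by rewrite JE; exact: dissipative_diff_coercive.
have Ju := coercive_unitmx beta_gt0 cJ.
pose l v := - ('d G (x, u x) (v, 0) *m invmx J).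
have l_linear : linear l.
  move=> a v w; rewrite /l.
  have -> : (a *: v + w, 0 : 'rV[R]_n) = a *: (v, 0) + (w, 0).
    by rewrite -[RHS]/(a *: v + w, a *: 0 + 0) scaler0 addr0.
  by rewrite linearP mulmxDl -scalemxAl opprD scalerN.
pose lM := GRing.isLinear.Build _ _ _ _ _ l_linear.
pose L : {linear V -> 'rV[R]_n} := HB.pack l lM.
have [k k0 kP] := linear_lipschitz (diff_continuous dG).
pose B := beta^-1 * n%:R.
have B0 : 0 <= B by rewrite mulr_ge0 ?invr_ge0 ?ler0n ?ltW.
have Lb v : `|L v| <= B * k * `|v|.
  have := dissipative_bound beta_gt0 (cJ (L v)).
  rewrite /= /l mulNmx mulmxKV // !enormN => h.
  apply: le_trans (normr_le_enorm _) _; rewrite enormN; apply: (le_trans h).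
  rewrite -!mulrA ler_wpM2l ?invr_ge0 ?(ltW beta_gt0) //.
  apply: le_trans (enorm_le_normr _) _; rewrite ler_wpM2l ?ler0n //.
  by apply: le_trans (kP _) _; rewrite normr_pair0l.
apply: (differentiable_of_expansion Lb) => e e0.
have Bk0 : 0 <= B * k by rewrite mulr_ge0 // ltW.
have b0 : 0 < 1 + B * k by rewrite ltr_wpDr.
(* [1 + B * k] bounds [(h, L h)] relative to [h], and [B] converts a value of [G] into a distance in
   the second component; dividing the tolerance by [c] compensates both. The summand 1 keeps [c]
   positive. *)
pose c := B * (1 + B * k) + 1.
have c0 : 0 < c by rewrite ltr_wpDl // mulr_ge0 // ltW.
have [r r0 rP] := differentiable_expansion dG (divr_gt0 e0 c0).
have pb h : `|(h, L h)| <= (1 + B * k) * `|h|.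
  rewrite prod_normE /= ge_max; apply/andP; split.
    by rewrite ler_peMl // lerDl mulr_ge0 // ltW.
  by apply: le_trans (Lb h) _; rewrite ler_wpM2r // lerDr.
exists (r / (1 + B * k)); first by rewrite divr_gt0.
move=> h hr; have hr' : `|(h, L h)| < r.
  by apply: le_lt_trans (pb h) _; rewrite mulrC -ltr_pdivlMr.
have := rP _ hr'; rewrite Gu subr0.
have -> : (h, L h) + (x, u x) = (h + x, u x + L h).
  by rewrite -[LHS]/(h + x, L h + u x) (addrC (L h)).
have -> : 'd G (x, u x) (h, L h) = 0.
  have -> : (h, L h) = (h, 0) + (0, L h).
    by rewrite -[RHS]/(h + 0, 0 + L h) addr0 add0r.
  by rewrite linearD /= -JE /l mulNmx mulmxKV // subrr.
rewrite subr0 => Gb.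
have := dissipative_lipschitz (h + x) (u (h + x)) (u x + L h).
rewrite Gu sub0r normrN opprD addrA => /le_trans; apply.
apply: le_trans (ler_wpM2l B0 Gb) _.
apply: le_trans (ler_wpM2l B0 (ler_wpM2l (ltW (divr_gt0 e0 c0)) (pb h))) _.
have -> : B * (e / c * ((1 + B * k) * `|h|)) =
   B * (1 + B * k) / c * (e * `|h|) by field; rewrite gt_eqF.
apply: ler_piMl; first by rewrite mulr_ge0 // ltW.
by rewrite ler_pdivrMr // mul1r /c lerDl.
Qed.

End Implicit.
End DiffTools.

(** * Product, chain and sum rules for directional derivatives *)

Section ScaleDiff.
Context {R : realType}.

Lemma differentiable_scale (V W : normedModType R) (a : V -> R) (b : V -> W) x :
  differentiable a x -> differentiable b x ->
  differentiable (fun y => a y *: b y) x /\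
  forall v, 'D_v (fun y => a y *: b y) x = 'D_v a x *: b x + a x *: 'D_v b x.
Proof.
move=> da db.
have bil : bilinear_for
    (GRing.Scale.Law.clone _ _ *:%R _) (GRing.Scale.Law.clone _ _ *:%R _)
    (@GRing.scale R W : R -> W -> W).
  split=> [u'|u] c y z /=; first by rewrite scalerDl scalerA.
  by rewrite scalerDr !scalerA mulrC.
pose sM := @bilinear_isBilinear.Build R R W W _ _ (@GRing.scale R W) bil.
pose s : {bilinear R -> W -> W} := HB.pack (@GRing.scale R W : R -> W -> W) sM.
have cs : continuous (fun p : R * W => s p.1 p.2).
  by move=> p; exact: scale_continuous.
have dp := differentiable_pair da db.
have ds := @differentiable_bilin _ _ _ _ s (a x, b x) cs.
have dsp := differentiable_comp dp ds.
split; first exact: dsp.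
move=> v; rewrite deriveE; last exact: dsp.
rewrite (@diff_comp _ _ _ _ (fun y => (a y, b y)) (fun p => s p.1 p.2)) //.
rewrite diff_bilin // diff_pair //= !deriveE //.
exact: addrC.
Qed.

Lemma differentiable_coordE (V : normedModType R) m n (u : V -> 'M[R]_(m, n)) x
    i j : differentiable u x ->
  differentiable (fun y => u y i j) x /\
  forall v, 'D_v (fun y => u y i j) x = 'D_v u x i j.
Proof.
move=> du; split=> [|v].
  exact: (differentiable_comp du (differentiable_coord _ _ _)).
by rewrite derive_mx ?mxE //; exact: diff_derivable.
Qed.

(** The vertical part of the chain rule is expanded on the basis because the direction ['D_v u x]
    moves with [x], whereas uniform bounds on [h] are available along fixed directions only. *)
Lemma differentiable_graph (V W : normedModType R) n (h : V * 'rV[R]_n -> W)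
    (u : V -> 'rV[R]_n) x : differentiable h (x, u x) -> differentiable u x ->
  differentiable (fun y => h (y, u y)) x /\
  forall v, 'D_v (fun y => h (y, u y)) x = 'D_(v, 0) h (x, u x) +
    \sum_(l < n) ('D_v u x) 0 l *: 'D_(0, delta_mx 0 l) h (x, u x).
Proof.
move=> dh du.
have dp : differentiable (fun y => (y, u y)) x by exact: differentiable_pair.
split=> [|v]; first exact: (differentiable_comp dp dh).
rewrite deriveE; last exact: (differentiable_comp dp dh).
rewrite (@diff_comp _ _ _ _ (fun y => (y, u y)) h) // diff_pair //=.
have -> : 'd u x v = 'D_v u x by rewrite deriveE.
rewrite diff_val.
have -> : (id v, 'D_v u x) = (v, 0) + (0, 'D_v u x).
  by rewrite -[RHS]/(v + 0, 0 + 'D_v u x) addr0 add0r.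
by rewrite linearD -(deriveE _ dh) pair0rE diff_lincomb.
Qed.

Lemma differentiable_sumE (V W : normedModType R) n (b : 'I_n -> V -> W) x :
  (forall l, differentiable (b l) x) ->
  differentiable (fun y => \sum_(l < n) b l y) x /\
  forall v, 'D_v (fun y => \sum_(l < n) b l y) x = \sum_(l < n) 'D_v (b l) x.
Proof.
move=> db; rewrite -fct_sumE; split=> [|v]; first exact: differentiable_sum.
by rewrite derive_sum // => l; exact: diff_derivable.
Qed.

End ScaleDiff.

(** * Uniformly bounded families of functions *)

Section Classes.
Context {R : realType} {I : Type}.

(* [unif_O m delta u]: all derivatives of [u i] of order at most [m] are
   [O(delta i)], uniformly in [i] and in space.  In [unif_grad m u] only the
   derivatives of order [1, ..., m] are required to be bounded. *)
Fixpoint unif_O (V W : normedModType R) (m : nat) (delta : I -> R)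
    (u : I -> V -> W) {struct m} : Prop :=
  (exists M, forall i x, `|u i x| <= M * delta i) /\
  if m is m'.+1 then
    (forall i x, differentiable (u i) x) /\
    forall v, unif_O m' delta (fun i x => 'D_v (u i) x : W)
  else True.

Definition unif_grad (V W : normedModType R) (m : nat) (u : I -> V -> W) : Prop :=
  if m is m'.+1 then
    (forall i x, differentiable (u i) x) /\
    forall v, unif_O m' (fun=> 1) (fun i x => 'D_v (u i) x : W)
  else True.

Section Calculus.
Variables (V : normedModType R).
Implicit Types (delta eta : I -> R) (m : nat).

Lemma unif_O_bound (W : normedModType R) m delta (u : I -> V -> W) :
  unif_O m delta u -> exists M, forall i x, `|u i x| <= M * delta i.
Proof. by case: m => [|m] []. Qed.

Lemma unif_O_lt (W : normedModType R) m delta (u : I -> V -> W) :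
  unif_O m.+1 delta u -> unif_O m delta u.
Proof.
elim: m u => [|m IH] u [ub [du Du]]; first by split.
by split=> //; split=> // v; exact/IH/Du.
Qed.

Lemma unif_grad_of_O (W : normedModType R) m (u : I -> V -> W) :
  unif_O m (fun=> 1) u -> unif_grad m u.
Proof. by case: m => // m [_ []]. Qed.

Lemma unif_grad_lt (W : normedModType R) m (u : I -> V -> W) :
  unif_grad m.+1 u -> unif_grad m u.
Proof.
case: m => // m [du Du]; split=> // v; exact/unif_O_lt/Du.
Qed.

Lemma unif_O_gauge (W : normedModType R) m delta eta C (u : I -> V -> W) :
  (forall i, 0 <= delta i <= C * eta i) -> unif_O m delta u -> unif_O m eta u.
Proof.
move=> dC.
have bd p (u' : I -> V -> W) : unif_O p delta u' ->
    exists M, forall i x, `|u' i x| <= M * eta i.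
  move=> /unif_O_bound[M ub]; exists (`|M| * C) => i x.
  have /andP[d0 dc] := dC i; rewrite -mulrA.
  apply: le_trans (ub i x) _; apply: (@le_trans _ _ (`|M| * delta i)).
    by rewrite ler_wpM2r // ler_norm.
  by rewrite ler_wpM2l.
elim: m u => [|m IH] u Hu; have ub := bd _ _ Hu; first by split.
by case: Hu => _ [du Du]; split=> //; split=> // v; exact/IH/Du.
Qed.

Lemma unif_O_cst (W : normedModType R) m delta (c : I -> W) :
  (exists M, forall i, `|c i| <= M * delta i) -> (forall i, 0 <= delta i) ->
  unif_O m delta (fun i (_ : V) => c i).
Proof.
move=> cb d0; elim: m c cb => [|m IH] c [M cM]; split; try by exists M.
  by [].
split=> [i x|v]; first exact: differentiable_cst.
have -> : (fun i (x : V) => 'D_v (fun=> c i) x) = fun i x => 0 : W.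
  by apply/funext => i; apply/funext => x; rewrite derive_cst.
by apply: IH; exists 0 => i; rewrite normr0 mul0r.
Qed.

Lemma unif_OD (W : normedModType R) m delta (u w : I -> V -> W) :
  unif_O m delta u -> unif_O m delta w ->
  unif_O m delta (fun i x => u i x + w i x).
Proof.
elim: m u w => [|m IH] u w [[M ub] Hu] [[N wb] Hw].
all: have bd : exists M, forall i x, `|u i x + w i x| <= M * delta i
  by exists (M + N) => i x; rewrite mulrDl;
     apply: le_trans (ler_normD _ _) _; exact: lerD.
  by split.
split=> //.
case: Hu Hw => [du Du] [dw Dw]; split=> [i x|v]; first exact: differentiableD.
have -> : (fun i x => 'D_v (fun x => u i x + w i x) x) =
    fun i x => 'D_v (u i) x + 'D_v (w i) x.
  by apply/funext => i; apply/funext => x; rewrite -deriveD //; exact: diff_derivable.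
exact: IH (Du v) (Dw v).
Qed.

(** Leibniz' rule, by induction on the order. Multiplying gauges is what later turns the factor
    [eps] of the recursion into a gain of one power. *)
Lemma unif_OZ (W : normedModType R) m delta eta (a : I -> V -> R)
    (b : I -> V -> W) :
  unif_O m delta a -> unif_O m eta b ->
  unif_O m (fun i => delta i * eta i) (fun i x => a i x *: b i x).
Proof.
have bd (c : I -> V -> R) (d : I -> V -> W) m' : unif_O m' delta c ->
    unif_O m' eta d ->
    exists M, forall i x, `|c i x *: d i x| <= M * (delta i * eta i).
  move=> /unif_O_bound[M cM] /unif_O_bound[N dN]; exists (M * N) => i x.
  by rewrite normrZ mulrACA; exact: ler_pM.
elim: m a b => [|m IH] a b Ha Hb; split; try exact: (bd _ _ _ Ha Hb).
  by [].
move: (Ha) (Hb) => [_ [da Da]] [_ [db Db]]; split=> [i x|v].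
  by have [] := differentiable_scale (da i x) (db i x).
have -> : (fun i x => 'D_v (fun x => a i x *: b i x) x) =
    fun i x => 'D_v (a i) x *: b i x + a i x *: 'D_v (b i) x.
  apply/funext => i; apply/funext => x.
  by have [_ ->] := differentiable_scale (da i x) (db i x).
apply: unif_OD; first exact: IH (Da v) (unif_O_lt Hb).
exact: IH (unif_O_lt Ha) (Db v).
Qed.

Lemma unif_OZ1l (W : normedModType R) m delta (a : I -> V -> R)
    (b : I -> V -> W) :
  unif_O m (fun=> 1) a -> unif_O m delta b ->
  unif_O m delta (fun i x => a i x *: b i x).
Proof.
move=> Ha Hb; have := unif_OZ Ha Hb; congr unif_O.
by apply/funext => i; rewrite mul1r.
Qed.

Lemma unif_OZ1r (W : normedModType R) m delta (a : I -> V -> R)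
    (b : I -> V -> W) :
  unif_O m delta a -> unif_O m (fun=> 1) b ->
  unif_O m delta (fun i x => a i x *: b i x).
Proof.
move=> Ha Hb; have := unif_OZ Ha Hb; congr unif_O.
by apply/funext => i; rewrite mulr1.
Qed.

Lemma unif_ON (W : normedModType R) m delta (u : I -> V -> W) :
  unif_O m delta u -> unif_O m delta (fun i x => - u i x).
Proof.
move=> Hu; have -> : (fun i x => - u i x) = fun i x => (-1) *: u i x.
  by apply/funext => i; apply/funext => x; rewrite scaleN1r.
apply: (unif_OZ1l _ Hu); apply: unif_O_cst => //.
by exists 1 => i; rewrite normrN normr1 mulr1.
Qed.

Lemma unif_OB (W : normedModType R) m delta (u w : I -> V -> W) :
  unif_O m delta u -> unif_O m delta w ->
  unif_O m delta (fun i x => u i x - w i x).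
Proof. by move=> Hu Hw; apply: unif_OD Hu _; exact: unif_ON. Qed.

Lemma unif_O0 (W : normedModType R) m delta :
  (forall i, 0 <= delta i) -> unif_O m delta (fun i (_ : V) => 0 : W).
Proof. by apply: unif_O_cst; exists 0 => i; rewrite normr0 mul0r. Qed.

Lemma unif_O_sum (W : normedModType R) m delta n (u : 'I_n -> I -> V -> W) :
  (forall i, 0 <= delta i) -> (forall l, unif_O m delta (u l)) ->
  unif_O m delta (fun i x => \sum_(l < n) u l i x).
Proof.
move=> d0; elim: n u => [|n IH] u Hu.
  have -> : (fun i x => \sum_(l < 0) u l i x) = fun i (x : V) => 0 : W.
    by apply/funext => i; apply/funext => x; rewrite big_ord0.
  exact: unif_O0.
have -> : (fun i x => \sum_(l < n.+1) u l i x) =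
    fun i x => \sum_(l < n) u (widen_ord (leqnSn n) l) i x + u ord_max i x.
  by apply/funext => i; apply/funext => x; rewrite big_ord_recr.
by apply: unif_OD => //; exact: IH.
Qed.

Lemma unif_O_coord m delta p q (u : I -> V -> 'M[R]_(p, q)) k l :
  unif_O m delta u -> unif_O m delta (fun i x => u i x k l).
Proof.
elim: m u => [|m IH] u Hu; have [M uM] := unif_O_bound Hu.
all: have bd : exists M, forall i x, `|u i x k l| <= M * delta i
  by exists M => i x; apply: le_trans (uM i x);
     rewrite [leRHS]mx_normrE; exact: (le_bigmax _ _ (k, l)).
  by split.
split=> //.
case: Hu => _ [du Du]; split=> [i x|v].
  by have [] := differentiable_coordE k l (du i x).
have -> : (fun i x => 'D_v (fun x => u i x k l) x) =
    fun i x => 'D_v (u i) x k l.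
  apply/funext => i; apply/funext => x.
  by have [_ ->] := differentiable_coordE k l (du i x).
exact: IH (Du v).
Qed.

End Calculus.
End Classes.

(** The assumed bounds depend on the direction. Finitely many spanning directions suffice, and the
    sum of their bounds serves for all coefficients [c] at once. *)
Lemma diff_span_bound (R : realType) (I : Type) (V W : normedModType R) n
    (e : 'I_n -> V) (h : I -> V -> W) :
  (forall i z, differentiable (h i) z) ->
  (forall v, exists M, forall i z, `|'D_v (h i) z| <= M) ->
  exists2 L : R, 0 <= L & forall i z (c : 'rV[R]_n),
    `|'d (h i) z (\sum_(l < n) c 0 l *: e l)| <= L * `|c|.
Proof.
move=> dh Dh; have {Dh} Dh l := cid (Dh (e l)).
exists (\sum_(l < n) `|sval (Dh l)|); first by apply: sumr_ge0.
move=> i z c; rewrite diff_lincomb // mulr_suml.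
apply: le_trans (ler_norm_sum _ _ _) _; apply: ler_sum => l _.
rewrite normrZ mulrC; apply: ler_pM => //; last exact: ler_coord_normr.
by case: (Dh l) => M hM /=; exact: le_trans (hM i z) (ler_norm _).
Qed.

(** * Composition with graphs *)

Section Composition.
Context {R : realType} {I : Type} {V : normedModType R} {n : nat}.
Implicit Types (delta : I -> R) (u : I -> V -> 'rV[R]_n).

(** Derivatives of the composite involve [u] itself only as a point of evaluation of [h], so [u] may
    be unbounded as long as its derivatives are not. *)
Lemma unif_O_graph (W : normedModType R) m (h : I -> V * 'rV[R]_n -> W) u :
  unif_O m (fun=> 1) h -> unif_grad m u ->
  unif_O m (fun=> 1) (fun i x => h i (x, u i x)).
Proof.
elim: m h => [|m IH] h Hh Hu; have [M hM] := unif_O_bound Hh.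
  by split=> //; exists M => i x; exact: hM.
case: (Hu) => du Du; case: (Hh) => _ [dh Dh].
have D i x := differentiable_graph (dh i (x, u i x)) (du i x).
split; first by exists M => i x; exact: hM.
split=> [i x|v]; first by have [] := D i x.
have -> : (fun i x => 'D_v (fun x => h i (x, u i x)) x) = fun i x =>
    'D_(v, 0) (h i) (x, u i x) + \sum_(l < n) ('D_v (u i) x) 0 l *:
      'D_(0, delta_mx 0 l) (h i) (x, u i x).
  by apply/funext => i; apply/funext => x; have [_ ->] := D i x.
have Hu' := unif_grad_lt Hu.
apply: unif_OD; first exact: IH (Dh _) Hu'.
apply: unif_O_sum => // l; apply: unif_OZ1l; last exact: IH (Dh _) Hu'.
exact: unif_O_coord (Du v).
Qed.

Lemma diff_vertical_bound (W : normedModType R) (h : I -> V * 'rV[R]_n -> W) :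
  (forall i z, differentiable (h i) z) ->
  (forall v, exists M, forall i z, `|'D_v (h i) z| <= M) ->
  exists2 L : R, 0 <= L &
    forall i z (w : 'rV[R]_n), `|'d (h i) z (0, w)| <= L * `|w|.
Proof.
move=> dh Dh.
have [L L0 hL] := diff_span_bound (fun l => (0, delta_mx 0 l)) dh Dh.
by exists L => // i z w; rewrite pair0rE; exact: hL.
Qed.

Lemma graph_sub_bound p m (h : I -> V * 'rV[R]_n -> 'rV[R]_p) :
  unif_O m.+1 (fun=> 1) h ->
  exists2 L : R, 0 <= L & forall i x y y',
    `|h i (x, y) - h i (x, y')| <= L * `|y - y'|.
Proof.
move=> [_ [dh Dh]].
have [|L L0 hL] := diff_vertical_bound dh.
  move=> v; have [M hM] := unif_O_bound (Dh v); exists M => i z.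
  by rewrite -[M]mulr1.
exists L => // i x y y'; apply: mean_value_bound => // z.
have -> : (x, y) - (x, y') = (0, y - y').
  by rewrite -[LHS]/(x - x, y - y') subrr.
exact: hL.
Qed.

(** The extra derivative of [h] pays for the mean value estimate at order zero. At higher order a
    difference of products is split so that each term contains either a derivative of [u - w] or a
    difference of derivatives of [h]; induction handles the latter. *)
Lemma unif_O_graph_sub p m delta (h : I -> V * 'rV[R]_n -> 'rV[R]_p) u w :
  (forall i, 0 <= delta i) ->
  unif_O m.+1 (fun=> 1) h -> unif_grad m u -> unif_grad m w ->
  unif_O m delta (fun i x => u i x - w i x) ->
  unif_O m delta (fun i x => h i (x, u i x) - h i (x, w i x)).
Proof.
move=> d0; elim: m h => [|m IH] h Hh Hu Hw Huw.
  have [L L0 hL] := graph_sub_bound Hh; have [M uwM] := unif_O_bound Huw.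
  split=> //; exists (L * M) => i x; rewrite -mulrA.
  exact: le_trans (hL _ _ _ _) (ler_wpM2l L0 (uwM i x)).
have [L L0 hL] := graph_sub_bound Hh; have [M uwM] := unif_O_bound Huw.
split.
  exists (L * M) => i x; rewrite -mulrA.
  exact: le_trans (hL _ _ _ _) (ler_wpM2l L0 (uwM i x)).
case: (Hh) => _ [dh Dh].
case: (Hu) (Hw) => [du Du] [dw Dw]; case: (Huw) => _ [_ Duw].
have DU i x := differentiable_graph (dh i (x, u i x)) (du i x).
have DW i x := differentiable_graph (dh i (x, w i x)) (dw i x).
split=> [i x|v].
  by apply: differentiableB; [case: (DU i x)|case: (DW i x)].
have -> : (fun i x => 'D_v (fun x => h i (x, u i x) - h i (x, w i x)) x) =
  fun i x => ('D_(v, 0) (h i) (x, u i x) - 'D_(v, 0) (h i) (x, w i x)) +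
   \sum_(l < n) (('D_v (fun x => u i x - w i x) x) 0 l *:
        'D_(0, delta_mx 0 l) (h i) (x, u i x) +
      'D_v (w i) x 0 l *: ('D_(0, delta_mx 0 l) (h i) (x, u i x) -
          'D_(0, delta_mx 0 l) (h i) (x, w i x))).
  apply/funext => i; apply/funext => x.
  have [dU EU] := DU i x; have [dW EW] := DW i x.
  rewrite deriveB; [|exact: diff_derivable..].
  rewrite EU EW opprD addrACA -sumrB; congr (_ + _); apply: eq_bigr => l _.
  rewrite deriveB; [|exact: diff_derivable..].
  by rewrite !mxE scalerBr addrA scalerBl subrK.
have Hu' := unif_grad_lt Hu; have Hw' := unif_grad_lt Hw.
have Huw' := unif_O_lt Huw.
apply: unif_OD; first exact: IH (Dh _) Hu' Hw' Huw'.
apply: unif_O_sum => // l; apply: unif_OD.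
  apply: unif_OZ1r; first exact: unif_O_coord (Duw v).
  exact: unif_O_graph (unif_O_lt (Dh _)) Hu'.
apply: unif_OZ1l; first exact: unif_O_coord (Dw v).
exact: IH (Dh _) Hu' Hw' Huw'.
Qed.

End Composition.

(** * Linear and implicit equations in the uniform classes *)

Section ImplicitClass.
Context {R : realType} {I : Type} {V : normedModType R} {n : nat}.
Variable beta : R.
Hypothesis beta_gt0 : 0 < beta.

(** The linear system is itself a dissipative implicit equation, affine in the unknown, so no
    inverse matrix has to be differentiated. *)
Lemma coercive_solution_differentiable (J : 'I_n -> V -> 'rV[R]_n)
    (u r : V -> 'rV[R]_n) x :
  (forall x (d : 'rV[R]_n), dotv (\sum_(l < n) d 0 l *: J l x) d <=
     - beta * enorm d ^+ 2) ->
  (forall l, differentiable (J l) x) -> differentiable r x ->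
  (forall x, \sum_(l < n) u x 0 l *: J l x = r x) ->
  differentiable u x.
Proof.
move=> cJ dJ dr Ju.
pose G (p : V * 'rV[R]_n) := \sum_(l < n) p.2 0 l *: J l p.1 - r p.1.
apply: (@implicit_differentiable _ _ _ G beta beta_gt0).
- move=> y d d'; rewrite /G /= opprB addrA subrK -sumrB.
  have := cJ y (d - d'); congr (dotv _ _ <= _).
  by apply: eq_bigr => l _; rewrite !mxE scalerBl.
- by move=> y; rewrite /G /= Ju subrr.
pose q : V * 'rV[R]_n := (x, u x).
have d1 (W : normedModType R) (f : V -> W) : differentiable f x ->
    differentiable (fun p : V * 'rV[R]_n => f p.1) q.
  move=> df.
  apply: (@differentiable_comp _ _ _ _ (@Datatypes.fst V 'rV[R]_n) f q) => //.
  exact: differentiable_fst.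
apply: differentiableB; last exact: d1.
have D (l : 'I_n) : differentiable (fun p : V * 'rV[R]_n => p.2 0 l *: J l p.1) q.
  have [] // := @differentiable_scale _ _ _ (fun p : V * 'rV[R]_n => p.2 0 l)
    (fun p => J l p.1) q; last exact: d1.
  apply: (@differentiable_comp _ _ _ _ (@Datatypes.snd V 'rV[R]_n)
    (fun w : 'rV[R]_n => w 0 l : R)); first exact: differentiable_snd.
  exact: differentiable_coord.
by have [] := differentiable_sumE D.
Qed.

(** Differentiating the system shows that ['D_v u] solves one with the same coefficients [J] and the
    right-hand side ['D_v r] minus the terms where [J] is differentiated. The gauge of [r] thus
    passes to [u] one order at a time. *)
Lemma unif_O_solve m delta (J : 'I_n -> I -> V -> 'rV[R]_n)
    (u r : I -> V -> 'rV[R]_n) : (forall i, 0 <= delta i) ->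
  (forall i x (d : 'rV[R]_n), dotv (\sum_(l < n) d 0 l *: J l i x) d <=
     - beta * enorm d ^+ 2) ->
  (forall l, unif_O m (fun=> 1) (J l)) -> unif_O m delta r ->
  (forall i x, \sum_(l < n) u i x 0 l *: J l i x = r i x) ->
  unif_O m delta u.
Proof.
move=> d0 cJ; elim: m u r => [|m IH] u r HJ Hr Ju.
all: have bd : exists M, forall i x, `|u i x| <= M * delta i.
1,3: have [M rM] := unif_O_bound Hr; exists (beta^-1 * n%:R * M) => i x;
  apply: le_trans (normr_le_enorm _) _;
  apply: (le_trans (dissipative_bound beta_gt0 (cJ i x _)));
  rewrite Ju -!mulrA ler_wpM2l ?invr_ge0 ?(ltW beta_gt0) //;
  apply: le_trans (enorm_le_normr _) _; rewrite ler_wpM2l ?ler0n //.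
  by split.
split=> //.
have dJ l i x : differentiable (J l i) x by have [_ []] := HJ l.
have dr i x : differentiable (r i) x by have [_ []] := Hr.
have du i x : differentiable (u i) x.
  exact: (coercive_solution_differentiable (cJ i) (fun l => dJ l i x) (dr i x)
    (Ju i)).
split=> // v.
have Hu : unif_O m delta u.
  apply: (IH u r) => //; first by move=> l; exact: unif_O_lt (HJ l).
  exact: unif_O_lt Hr.
apply: (IH _ (fun i x => 'D_v (r i) x -
    \sum_(l < n) u i x 0 l *: 'D_v (J l i) x)).
- by move=> l; exact: unif_O_lt (HJ l).
- apply: unif_OB; first by have [_ [_ Dr]] := Hr; exact: Dr.
  apply: unif_O_sum => // l; apply: unif_OZ1r; first exact: unif_O_coord Hu.
  by have [_ [_ DJ]] := HJ l; exact: DJ.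
move=> i x.
have D l := differentiable_scale (differentiable_coordE 0 l (du i x)).1 (dJ l i x).
have -> : r i = fun x => \sum_(l < n) u i x 0 l *: J l i x.
  by apply/funext => y; rewrite Ju.
rewrite (differentiable_sumE (fun l => (D l).1)).2 -sumrB; apply: eq_bigr => l _.
by rewrite (D l).2 addrK (differentiable_coordE 0 l (du i x)).2.
Qed.

Variable g : I -> V * 'rV[R]_n -> 'rV[R]_n.
Hypothesis gdiss : forall i x y y',
  dotv (g i (x, y) - g i (x, y')) (y - y') <= - beta * enorm (y - y') ^+ 2.

Lemma vertical_derivative_coercive i z (d : 'rV[R]_n) : differentiable (g i) z ->
  dotv (\sum_(l < n) d 0 l *: 'D_(0, delta_mx 0 l) (g i) z) d <=
    - beta * enorm d ^+ 2.
Proof.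
case: z => x y dg.
have := dissipative_diff_coercive (gdiss i) d dg.
by rewrite pair0rE diff_lincomb.
Qed.

(** A bootstrap: gradient bounds on [u] up to order [m] control the coefficients [Dg (x, u x)] up to
    order [m], and the linear system for ['D_v u] then yields order [m.+1]. *)
Lemma unif_grad_implicit m (u w : I -> V -> 'rV[R]_n) :
  unif_grad m g -> unif_grad m w -> (forall i x, g i (x, u i x) = w i x) ->
  unif_grad m u.
Proof.
move=> + + gu; elim: m => [|m IH] // Hg Hw.
have Hu := IH (unif_grad_lt Hg) (unif_grad_lt Hw).
have [dg Dg] := Hg; have [dw Dw] := Hw.
have du i x : differentiable (u i) x.
  apply: (@implicit_differentiable _ _ _ (fun z => g i z - w i z.1) beta) => //.
  - by move=> y d d' /=; rewrite opprB addrA subrK; exact: gdiss.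
  - by move=> y /=; rewrite gu subrr.
  apply: differentiableB => //.
  apply: (@differentiable_comp _ _ _ _ (@Datatypes.fst V 'rV[R]_n) (w i)).
    exact: differentiable_fst.
  exact: dw.
split=> // v.
apply: (@unif_O_solve _ _ (fun l i x => 'D_(0, delta_mx 0 l) (g i) (x, u i x)) _
  (fun i x => 'D_v (w i) x - 'D_(v, 0) (g i) (x, u i x))) => //.
- by move=> i x d; exact: vertical_derivative_coercive.
- by move=> l; exact: (unif_O_graph (Dg _) Hu).
- by apply: unif_OB => //; exact: (unif_O_graph (Dg _) Hu).
move=> i x; have [_ E] := differentiable_graph (dg i (x, u i x)) (du i x).
have -> : w i = fun x => g i (x, u i x) by apply/funext => y; rewrite gu.
by rewrite E addrC addKr.
Qed.

Lemma unif_O_implicit_sub m delta (u w : I -> V -> 'rV[R]_n) :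
  (forall i, 0 <= delta i) ->
  unif_grad m.+1 g -> unif_grad m u -> unif_grad m w ->
  unif_O m delta (fun i x => g i (x, u i x) - g i (x, w i x)) ->
  unif_O m delta (fun i x => u i x - w i x).
Proof.
move=> d0; elim: m => [|m IH] Hg Hu Hw Hgu.
all: have bd : exists M, forall i x, `|u i x - w i x| <= M * delta i.
1,3: have [M gM] := unif_O_bound Hgu; exists (beta^-1 * n%:R * M) => i x;
  apply: (le_trans (dissipative_lipschitz beta_gt0 (gdiss i) x _ _));
  rewrite -[leRHS]mulrA ler_wpM2l ?mulr_ge0 ?ler0n ?invr_ge0 ?(ltW beta_gt0) //.
  by split.
have Huw : unif_O m delta (fun i x => u i x - w i x).
  exact: IH (unif_grad_lt Hg) (unif_grad_lt Hu) (unif_grad_lt Hw) (unif_O_lt Hgu).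
split; first exact: bd.
have [dg Dg] := Hg; have [du Du] := Hu; have [dw Dw] := Hw.
split=> [i x|v]; first exact: differentiableB.
have Hu' := unif_grad_lt Hu; have Hw' := unif_grad_lt Hw.
(* Differentiating [g (x, u) - g (x, w)] and isolating the vertical derivative of [g] at [u] applied
   to ['D_v (u - w)] leaves these terms; each is the given derivative or contains a difference of
   derivatives of [g], hence has gauge [delta]. *)
apply: (@unif_O_solve _ _ (fun l i x => 'D_(0, delta_mx 0 l) (g i) (x, u i x)) _
  (fun i x => 'D_v (fun x => g i (x, u i x) - g i (x, w i x)) x -
     ('D_(v, 0) (g i) (x, u i x) - 'D_(v, 0) (g i) (x, w i x)) -
     \sum_(l < n) 'D_v (w i) x 0 l *: ('D_(0, delta_mx 0 l) (g i) (x, u i x) -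
          'D_(0, delta_mx 0 l) (g i) (x, w i x)))) => //.
- by move=> i x d; exact: vertical_derivative_coercive.
- by move=> l; exact: (unif_O_graph (unif_O_lt (Dg _)) Hu').
- apply: unif_OB; first apply: unif_OB.
  + by have [_ [_ Dgu]] := Hgu; exact: Dgu.
  + exact: (unif_O_graph_sub d0 (Dg _) Hu' Hw' Huw).
  apply: unif_O_sum => // l; apply: unif_OZ1l; first exact: unif_O_coord (Dw v).
  exact: (unif_O_graph_sub d0 (Dg _) Hu' Hw' Huw).
move=> i x.
have [dU EU] := differentiable_graph (dg i (x, u i x)) (du i x).
have [dW EW] := differentiable_graph (dg i (x, w i x)) (dw i x).
rewrite !deriveB; [|exact: diff_derivable..].
have cancel (a b c d e : 'rV[R]_n) : (a + c) - (b + d) - (a - b) - e = c - d - e.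
  by apply/rowP => j; rewrite !mxE; ring.
rewrite EU EW cancel -!sumrB; apply: eq_bigr => l _.
by rewrite !mxE scalerBl scalerBr opprB addrA subrK.
Qed.

End ImplicitClass.

(** * Solvability of dissipative equations *)

HB.instance Definition _ (R : realType) m n :=
  Uniform_isComplete.Build 'M[R]_(m, n) (@cauchy_cvg _).

Section Existence.
Context {R : realType} {n : nat}.

(* The contraction property is assumed for the Euclidean norm while the library
   metric is that of the sup norm: some iterate of [T] is a contraction for the
   latter. *)
Lemma enorm_contraction_fixed (T : 'rV[R]_n -> 'rV[R]_n) (q : R) :
  0 <= q < 1 -> (forall y y', enorm (T y - T y') <= q * enorm (y - y')) ->
  exists p, T p = p.
Proof.
move=> /andP[q0 q1] Tq.
have [N qN] : exists N : nat, q ^+ N * n%:R < 1.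
  have qc : q ^+ k @[k --> \oo] --> 0 by apply: cvg_expr; rewrite ger0_norm.
  have n0 : 0 < (n%:R + 1)^-1 :> R by rewrite invr_gt0 ltr_wpDl.
  have [N _ NP] := (cvgrPdist_lt _ _).1 qc _ n0.
  exists N; have := NP N (leqnn N); rewrite /= sub0r normrN ger0_norm ?exprn_ge0 //.
  move=> h; apply: (@le_lt_trans _ _ (q ^+ N * (n%:R + 1))).
    by rewrite ler_wpM2l ?exprn_ge0 // lerDl.
  by rewrite -ltr_pdivlMr ?ltr_wpDl // mul1r.
have itq k y y' : enorm (iter k T y - iter k T y') <= q ^+ k * enorm (y - y').
  elim: k => [|k IH]; first by rewrite mul1r.
  by rewrite exprS -mulrA; apply: le_trans (Tq _ _) _; rewrite ler_wpM2l.
have itn y y' : `|iter N T y - iter N T y'| <= q ^+ N * n%:R * `|y - y'|.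
  apply: le_trans (normr_le_enorm _) (le_trans (itq _ _ _) _).
  by rewrite -mulrA ler_wpM2l ?exprn_ge0 // enorm_le_normr.
have qn0 : 0 <= q ^+ N * n%:R by rewrite mulr_ge0 ?exprn_ge0.
pose F : {fun [set: 'rV[R]_n] >-> [set: 'rV[R]_n]} :=
  HB.pack (iter N T) (isFun.Build _ _ setT setT (iter N T) (fun _ _ => I)).
have ctr : is_contraction F.
  exists (NngNum qn0); split=> //= -[y y'] _ /=; exact: itn.
have [|p _ pF] := banach_fixed_point ctr closedT; first by exists 0.
(* [T p] is again a fixed point of the iterate, and a contraction has only one. *)
exists p; apply/eqP; rewrite -subr_eq0 -normr_le0.
have := itn (T p) p; rewrite -iterSr iterS -[iter N T p]/(F p) -pF => h.
rewrite leNgt; apply/negP => h0; move: h.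
by rewrite -ler_pdivrMr // divff ?gt_eqF // leNgt qN.
Qed.

(** A solution is a fixed point of the relaxation [y + tau *: (G y - w)]. Its squared Lipschitz
    constant is at most [1 - 2 * tau * beta + tau ^+ 2 * K ^+ 2]; the minimizer
    [tau = beta / K ^+ 2] gives [1 - (beta / K) ^+ 2]. Taking [K] above both [L] and [beta] keeps
    this in the right range. *)
Lemma dissipative_surjective (G : 'rV[R]_n -> 'rV[R]_n) (beta L : R) w :
  0 < beta ->
  (forall y y', dotv (G y - G y') (y - y') <= - beta * enorm (y - y') ^+ 2) ->
  (forall y y', enorm (G y - G y') <= L * enorm (y - y')) ->
  exists y, G y = w.
Proof.
move=> b0 Gd GL.
pose K := `|L| + beta + 1.
have K0 : 0 < K by rewrite ltr_wpDl ?addr_ge0 // ltW.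
have bK : beta < K by rewrite /K addrAC ltrDr ltr_wpDl.
pose tau := beta / K ^+ 2.
have t0 : 0 < tau by rewrite divr_gt0 ?exprn_gt0.
pose r := beta / K.
have r0 : 0 < r by rewrite divr_gt0.
have r1 : r < 1 by rewrite ltr_pdivrMr // mul1r.
have s0 : 0 <= 1 - r ^+ 2 by rewrite subr_ge0 expr_le1 // ltW.
pose q := Num.sqrt (1 - r ^+ 2).
have q1 : 0 <= q < 1.
  rewrite sqrtr_ge0 /= -[X in _ < X]sqrtr1 ltr_sqrt //.
  by rewrite ltrBlDr ltrDl exprn_gt0.
have [|p] := @enorm_contraction_fixed (fun y => y + tau *: (G y - w)) q q1.
  move=> y y'.
  have -> : y + tau *: (G y - w) - (y' + tau *: (G y' - w)) =
     (y - y') + tau *: (G y - G y') by apply/rowP => j; rewrite !mxE; ring.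
  have := Gd y y'; have := GL y y'; move: (y - y') (G y - G y') => d D.
  move=> DL Dd; rewrite -ler_sqr ?nnegrE ?mulr_ge0 ?enorm_ge0 ?sqrtr_ge0 //.
  have q2 : q ^+ 2 = 1 - r ^+ 2 by rewrite sqr_sqrtr.
  rewrite exprMn q2 sqr_enorm dotvDl !(dotvC _ (d + _)) !dotvDl.
  rewrite !dotvZl !dotvZr (dotvC d D) -!sqr_enorm.
  have DK : enorm D ^+ 2 <= K ^+ 2 * enorm d ^+ 2.
    rewrite -exprMn ler_sqr ?nnegrE ?mulr_ge0 ?enorm_ge0 ?(ltW K0) //.
    apply: le_trans DL _; rewrite ler_wpM2r ?enorm_ge0 //.
    by rewrite /K -addrA ler_wpDr ?ler_norm // addr_ge0 // ltW.
  have e1 : tau * beta = r ^+ 2 by rewrite /tau /r; field; rewrite gt_eqF.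
  have e2 : tau ^+ 2 * K ^+ 2 = r ^+ 2.
    by rewrite /tau /r; field; rewrite gt_eqF.
  have h1 : tau * dotv D d <= - r ^+ 2 * enorm d ^+ 2.
    have -> : - r ^+ 2 * enorm d ^+ 2 = tau * (- beta * enorm d ^+ 2).
      by rewrite -e1; ring.
    by rewrite ler_pM2l.
  have h2 : tau ^+ 2 * enorm D ^+ 2 <= r ^+ 2 * enorm d ^+ 2.
    by rewrite -e2 -[leRHS]mulrA ler_pM2l ?exprn_gt0.
  move: h1 h2; rewrite mulrBl mul1r; lra.
move=> /(congr1 (fun v => v - p)); rewrite addrC addKr subrr => /eqP.
rewrite scaler_eq0 gt_eqF //= subr_eq0 => /eqP; by exists p.
Qed.

End Existence.

(** * Approximate solutions and stable flows *)

Section ProductEuclid.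
Context {R : realType} {n m : nat}.
Local Notation V := ('rV[R]_n * 'rV[R]_m)%type.
Implicit Types z : V.

(** Identifies the product with one row space in which [enorm2] becomes [enorm], so that
    Cauchy-Schwarz and Gronwall carry over. *)
Definition joinv (z : V) : 'rV[R]_(n + m) := row_mx z.1 z.2.

Lemma joinv_linear : linear joinv.
Proof. by move=> a [x y] [x' y']; rewrite /joinv /= scale_row_mx add_row_mx. Qed.

HB.instance Definition _ := GRing.isLinear.Build R V 'rV[R]_(n + m) _ joinv
  joinv_linear.

Lemma enorm2E z : enorm2 z = enorm (joinv z).
Proof.
rewrite /enorm2 /joinv {3}/enorm; congr Num.sqrt.
rewrite !sqr_enorm [in RHS]/dotv big_split_ord.
by congr (_ + _); apply: eq_bigr => i _; rewrite ?row_mxEl ?row_mxEr.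
Qed.

Lemma normr_joinv z : `|joinv z| <= `|z|.
Proof.
rewrite [leLHS]mx_normrE; apply: bigmax_le => // -[i j] _ /=.
rewrite (ord1 i) mxE prod_normE; case: (fintype.split j) => l.
  by rewrite le_max ler_coord_normr.
by rewrite le_max ler_coord_normr orbT.
Qed.

Lemma joinv_continuous : continuous joinv.
Proof.
apply: bounded_linear_continuous.
apply/ex_bound; exists 1; apply/nbhs_ballP; exists 1 => //= v.
rewrite -ball_normE /= sub0r normrN => v1.
exact: le_trans (normr_joinv v) (ltW v1).
Qed.

Lemma is_derive_joinv (z : R -> V) (t : R) d : is_derive t 1 z d ->
  is_derive t 1 (fun s => joinv (z s)) (joinv d).
Proof.
move=> zd.
have dj : differentiable joinv (z t).
  by apply: linear_differentiable; exact: joinv_continuous.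
have := is_derive_comp_curve zd dj.
by rewrite (diff_lin _ joinv_continuous).
Qed.

Lemma enorm2_ge0 z : 0 <= enorm2 z.
Proof. exact: sqrtr_ge0. Qed.

Lemma enorm2_0 : enorm2 (0 : V) = 0.
Proof. by rewrite enorm2E linear0 enorm0. Qed.

Lemma enorm2N z : enorm2 (- z) = enorm2 z.
Proof. by rewrite !enorm2E linearN enormN. Qed.

Lemma enorm2D z z' : enorm2 (z + z') <= enorm2 z + enorm2 z'.
Proof. by rewrite !enorm2E linearD enormD. Qed.

Lemma enorm2_le z : enorm2 z <= enorm z.1 + enorm z.2.
Proof.
have -> : z = (z.1, 0) + (0, z.2).
  by case: z => x y; rewrite -[RHS]/(x + 0, 0 + y) addr0 add0r.
apply: le_trans (enorm2D _ _) _; rewrite /enorm2 /= !enorm0 expr0n /= addr0 add0r.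
by rewrite !sqrtr_sqr addr0 add0r !ger0_norm ?enorm_ge0.
Qed.

Lemma enorm_fst_le z : enorm z.1 <= enorm2 z.
Proof.
rewrite -[leLHS]ger0_norm ?enorm_ge0 // -sqrtr_sqr.
by rewrite ler_sqrt ?addr_ge0 ?sqr_ge0 // lerDl sqr_ge0.
Qed.

Lemma enorm_snd_le z : enorm z.2 <= enorm2 z.
Proof.
rewrite -[leLHS]ger0_norm ?enorm_ge0 // -sqrtr_sqr.
by rewrite ler_sqrt ?addr_ge0 ?sqr_ge0 // lerDr sqr_ge0.
Qed.

Lemma enorm2_eq0 z : enorm2 z = 0 -> z = 0.
Proof.
move=> z0; have := enorm_fst_le z; have := enorm_snd_le z; rewrite z0 => h2 h1.
have e1 : enorm z.1 = 0 by apply: le_anti; rewrite h1 enorm_ge0.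
have e2 : enorm z.2 = 0 by apply: le_anti; rewrite h2 enorm_ge0.
by rewrite [z]surjective_pairing (enorm0_eq0 e1) (enorm0_eq0 e2).
Qed.

(** The scalar mean value theorem is applied to the inner product with the total increment [u];
    testing against [u] itself preserves the constant [A] exactly. *)
Lemma enorm2_mean_value (P : V -> V) (A : R) : (forall z, differentiable P z) ->
  (forall z v, enorm2 ('d P z v) <= A * enorm2 v) ->
  forall a b, enorm2 (P a - P b) <= A * enorm2 (a - b).
Proof.
move=> dP PA a b; set u := joinv (P a - P b).
have [u0|u0] := eqVneq (enorm u) 0.
  rewrite enorm2E -/u u0; apply: le_trans (PA a (a - b)); exact: enorm2_ge0.
have ugt : 0 < enorm u by rewrite lt_neqAle eq_sym u0 enorm_ge0.
pose c s := b + s *: (a - b).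
have dc (s : R) : is_derive s 1 (fun s => dotv (joinv (P (c s))) u)
    (dotv (joinv ('d P (c s) (a - b))) u).
  have h (j : 'I_(n + m)) := is_derive_coord 0 j (is_derive_joinv
    (is_derive_segment (dP (b + s *: (a - b))))).
  have -> : (fun s => dotv (joinv (P (c s))) u) =
     \sum_(j < n + m) (fun s => u 0 j * joinv (P (c s)) 0 j).
    by rewrite fct_sumE; apply/funext => s'; apply: eq_bigr => j _; rewrite mulrC.
  have -> : dotv (joinv ('d P (c s) (a - b))) u =
     \sum_(j < n + m) u 0 j * joinv ('d P (c s) (a - b)) 0 j.
    by apply: eq_bigr => j _; rewrite mulrC.
  by apply: is_derive_sum => j; exact: is_deriveZ.
have [|s _] := @MVT _ _ _ 0 1 ltr01 (fun s _ => dc s).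
  apply: continuous_subspaceT => s.
  by apply/differentiable_continuous/derivable1_diffP; have [] := dc s.
rewrite /c scale1r scale0r addr0 subr0 mulr1 subrKC -dotvBl -linearB -/u.
rewrite -sqr_enorm => uE; rewrite enorm2E -/u -(ler_pM2r ugt) -expr2 uE.
apply: le_trans (cauchy_schwarz _ _) _; rewrite ler_pM2r //.
by rewrite -enorm2E.
Qed.

End ProductEuclid.

(** * Approximate solutions compared with the flow *)

Section Flow.
Context {R : realType} {n m : nat}.
Local Notation V := ('rV[R]_n * 'rV[R]_m)%type.
Variables (F : V -> V) (L : R).
Hypothesis L_ge0 : 0 <= L.
Hypothesis F_lipschitz : forall a b, enorm2 (F a - F b) <= L * enorm2 (a - b).

Definition approx_solution (c : R) (z : R -> V) : Prop :=
  z t @[t --> 0^'+] --> z 0 /\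
  forall t : R, 0 < t ->
    exists2 d, is_derive t 1 z d & enorm2 (d - F (z t)) <= c.

Lemma approx_solution0 z0 z : is_solution F z0 z -> approx_solution 0 z.
Proof.
move=> [_ zc zd]; split=> // t /zd dz; exists (F (z t)) => //.
by rewrite subrr enorm2_0.
Qed.

Lemma approx_solution_gap c1 c2 (z1 z2 : R -> V) : 0 <= c1 -> 0 <= c2 ->
  approx_solution c1 z1 -> approx_solution c2 z2 ->
  forall t : R, 0 <= t -> enorm2 (z1 t - z2 t) <=
    expR (L * t) * (enorm2 (z1 0 - z2 0) + (c1 + c2) * t).
Proof.
move=> c10 c20 [zc1 zd1] [zc2 zd2] t t0.
rewrite !enorm2E.
apply: (gronwall (e := fun s => joinv (z1 s - z2 s)) L_ge0 (addr_ge0 c10 c20))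
  => //.
  apply: (@continuous_cvg _ _ _ _ _ (fun s => z1 s - z2 s) joinv).
    exact: joinv_continuous.
  exact: cvgB.
move=> s s0; have [d1 zd1s d1b] := zd1 s s0; have [d2 zd2s d2b] := zd2 s s0.
exists (joinv (d1 - d2)).
  by apply: is_derive_joinv; exact: is_deriveB.
set e := joinv (z1 s - z2 s).
have -> : d1 - d2 = (F (z1 s) - F (z2 s)) + ((d1 - F (z1 s)) - (d2 - F (z2 s))).
  by rewrite opprB addrA [X in _ = X + _]addrC subrKA subrKA.
apply: le_trans (cauchy_schwarz _ _) _; rewrite mulrC.
apply: (@le_trans _ _ ((L * enorm e + (c1 + c2)) * enorm e)); last first.
  by rewrite mulrDl expr2 mulrA.
rewrite ler_wpM2r ?enorm_ge0 // -enorm2E /e -enorm2E.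
apply: le_trans (enorm2D _ _) (lerD (F_lipschitz _ _) _).
by apply: le_trans (enorm2D _ _) _; rewrite enorm2N; exact: lerD.
Qed.

Lemma approx_solution_shift c (z : R -> V) (s : R) : 0 <= s ->
  approx_solution c z -> approx_solution c (fun t => z (t + s)).
Proof.
(* At [s = 0] only the assumed right continuity is available; for [s > 0] continuity at the new
   origin follows from differentiability of [z] at [s]. *)
rewrite le_eqVlt => /orP[/eqP <-|s0] [zc zd].
  have -> : (fun t => z (t + 0)) = z by apply/funext => t; rewrite addr0.
  by split.
have dshift (t : R) d : is_derive (t + s) 1 z d ->
    is_derive t 1 (fun t => z (t + s)) d.
  move=> [dz <-]; have dz' := (derivable1_diffP _ _).1 dz.
  have ds : is_derive t 1 (fun t : R => t + s) 1.
    by apply: is_derive_eq; exact: addr0.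
  have := @is_derive_comp_curve _ _ _ z (fun t : R => t + s) t _ ds dz'.
  by rewrite -deriveE.
split=> [|t t0]; last first.
  have [d dz db] := zd (t + s) (addr_gt0 t0 s0).
  by exists d => //; exact: dshift.
apply: cvg_at_right_filter.
have [d dz _] := zd s s0.
have dz0 : is_derive (0 + s) 1 z d by rewrite add0r.
have [/derivable1_diffP dd _] := dshift 0 d dz0.
exact: differentiable_continuous dd.
Qed.

Variable Phi : R -> V -> V.
Hypothesis Phi_flow : is_flow_map F Phi.

Lemma flow0 z : Phi 0 z = z.
Proof. by case: (Phi_flow z). Qed.

Lemma solution_flow c (z : R -> V) (t : R) : 0 <= c -> approx_solution c z ->
  0 <= t -> enorm2 (z t - Phi t (z 0)) <= expR (L * t) * (c * t).
Proof.
move=> c0 za t0.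
have := approx_solution_gap c0 (lexx 0) za (approx_solution0 (Phi_flow (z 0))) t0.
by rewrite flow0 subrr enorm2_0 addr0 add0r.
Qed.

(** Uniqueness, as the Gronwall estimate with zero defect. It yields the semigroup law, which
    [is_flow_map] does not include, and identifies the given trajectory with the flow. *)
Lemma exact_solution_flow (z : R -> V) (t : R) : approx_solution 0 z ->
  0 <= t -> z t = Phi t (z 0).
Proof.
move=> za t0; apply/eqP; rewrite -subr_eq0; apply/eqP/enorm2_eq0/le_anti.
by rewrite enorm2_ge0 andbT; have := solution_flow (lexx 0) za t0; rewrite mul0r mulr0.
Qed.

Lemma flowD z (s t : R) : 0 <= s -> 0 <= t -> Phi (t + s) z = Phi t (Phi s z).
Proof.
move=> s0 t0; have := approx_solution_shift s0 (approx_solution0 (Phi_flow z)).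
by move=> /exact_solution_flow -/(_ _ t0); rewrite add0r.
Qed.

(* Lady Windermere's fan: the defect committed on each of [N] small steps is
   transported to the final time by the flow.  The steps are chosen so small
   that the Gronwall factor of a single step is at most [e], whatever [L]. *)
Lemma fan (A c t : R) (W : R -> V) : 0 <= A -> 0 <= c -> 0 <= t -> approx_solution c W ->
  (forall s a b, 0 <= s <= t -> enorm2 (Phi s a - Phi s b) <= A * enorm2 (a - b)) ->
  enorm2 (W t - Phi t (W 0)) <= A * (expR 1 * c * t).
Proof.
move=> A0 c0 t0 Wa PhiA.
pose N := (Num.truncn (L * t)).+1.
have N0 : 0 < N%:R :> R by rewrite ltr0n.
have LN : L * t < N%:R by rewrite truncnS_gt.
pose d := t / N%:R.
have d0 : 0 <= d by rewrite divr_ge0 // ltW.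
have Ld : L * d <= 1 by rewrite /d mulrA ler_pdivrMr // mul1r ltW.
have tE : t = d * N%:R by rewrite /d divfK // gt_eqF.
(* Follow [W] for [i] steps and the exact flow afterwards: [h 0] is [Phi t (W 0)] and [h N] is
   [W t]. *)
pose h (i : nat) := Phi (t - d * i%:R) (W (d * i%:R)).
have step i : (i < N)%N -> enorm2 (h i.+1 - h i) <= A * (expR 1 * c * d).
  move=> iN; rewrite /h.
  have s1 : 0 <= t - d * i.+1%:R.
    by rewrite subr_ge0 [leRHS]tE ler_wpM2l // ler_nat.
  have si : 0 <= d * i%:R by rewrite mulr_ge0.
  have -> : t - d * i%:R = (t - d * i.+1%:R) + d.
    by rewrite -natr1; ring.
  rewrite (flowD _ d0 s1).
  have s1t : 0 <= t - d * i.+1%:R <= t by rewrite s1 gerBl mulr_ge0.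
  apply: le_trans (PhiA _ (W (d * i.+1%:R)) (Phi d (W (d * i%:R))) s1t) _.
  rewrite ler_wpM2l //.
  have := solution_flow c0 (approx_solution_shift si Wa) d0.
  rewrite add0r.
  have -> : d + d * i%:R = d * i.+1%:R by rewrite -natr1; ring.
  move=> /le_trans; apply; rewrite -mulrA ler_wpM2r ?mulr_ge0 //.
  by rewrite ler_expR.
have sum i : (i <= N)%N -> enorm2 (h i - h 0) <= A * (expR 1 * c * d) * i%:R.
  elim: i => [_|i IH iN].
    by rewrite subrr mulr0 enorm2_0.
  have -> : h i.+1 - h 0 = (h i.+1 - h i) + (h i - h 0) by rewrite addrA subrK.
  apply: le_trans (enorm2D _ _) _; rewrite -natr1 mulrDr mulr1 addrC.
  by apply: lerD; [exact: IH (ltnW iN)|exact: step].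
have := sum N (leqnn N); rewrite /h -tE subrr flow0 mulr0 subr0.
move=> /le_trans; apply; rewrite [in leRHS]tE le_eqVlt; apply/orP; left.
by apply/eqP; ring.
Qed.

End Flow.

(** * Correction models *)

Section RegularityClasses.
Context {R : realType} (I : Type).

Lemma unif_O_le (V W : normedModType R) m p (delta : I -> R) (u : I -> V -> W) :
  (m <= p)%N -> unif_O p delta u -> unif_O m delta u.
Proof.
move=> /subnK <-; elim: (p - m)%N => // d IH; rewrite addSn => Hu.
exact/IH/unif_O_lt.
Qed.

Lemma unif_grad_le (V W : normedModType R) m p (u : I -> V -> W) :
  (m <= p)%N -> unif_grad p u -> unif_grad m u.
Proof.
move=> /subnK <-; elim: (p - m)%N => // d IH; rewrite addSn => Hu.
exact/IH/unif_grad_lt.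
Qed.

Lemma unif_O_of_Winfty (V W : normedModType R) m (F : V -> W) :
  (forall vs : seq V, (size vs < m)%N ->
    forall z, differentiable (Defs.iterD vs F) z) ->
  Winfty m F -> unif_O m (fun=> 1) (fun _ : I => F).
Proof.
elim: m F => [|m IH] F dF bF.
  split=> //; have [M FM] := bF [::] isT.
  by exists M => _ z; rewrite mulr1; exact: FM.
split; first by have [M FM] := bF [::] isT; exists M => _ z; rewrite mulr1; exact: FM.
split=> [_ z|v]; first exact: (dF [::]).
(* [iterD] applies the head of the list last, while [unif_O] differentiates [F] along the new
   direction first, which therefore goes to the end of the list. *)
have e vs : Defs.iterD vs (fun z => 'D_v F z) = Defs.iterD (rcons vs v) F.
  by rewrite /Defs.iterD foldr_rcons.
apply: (IH (fun z => 'D_v F z)) => vs vsm.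
  by rewrite e; apply: dF; rewrite size_rcons.
by rewrite e; apply: bF; rewrite size_rcons.
Qed.

Lemma unif_grad_of_Winfty (V W : normedModType R) m (F : V -> W) :
  smooth m.+1 F -> (forall v : V, Winfty m (fun z => 'D_v F z)) ->
  unif_grad m.+1 (fun _ : I => F).
Proof.
move=> [dF _] bF; split=> [_ z|v]; first exact: (dF [::]).
apply: (unif_O_of_Winfty _ (bF v)) => vs vsm.
have -> : Defs.iterD vs (fun z => 'D_v F z) = Defs.iterD (rcons vs v) F.
  by rewrite /Defs.iterD foldr_rcons.
by apply: dF; rewrite size_rcons.
Qed.

End RegularityClasses.

Section ProductLipschitz.
Context {R : realType} {n m : nat}.

Lemma enorm_lipschitz p (h : 'rV[R]_n * 'rV[R]_m -> 'rV[R]_p) :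
  unif_grad 1 (fun _ : unit => h) ->
  exists2 L : R, 0 <= L & forall a b, enorm (h a - h b) <= L * enorm2 (a - b).
Proof.
move=> [dh Dh].
have bh v : exists M : R, forall (i : unit) z, `|'D_v h z| <= M.
  by have [M hM] := unif_O_bound (Dh v); exists M => i z; rewrite -[M]mulr1; exact: hM.
have [L1 L10 hL1] := diff_span_bound (fun l => (delta_mx 0 l, 0)) dh bh.
have [L2 L20 hL2] := diff_vertical_bound dh bh.
exists (p%:R * (L1 + L2)); first by rewrite mulr_ge0 ?addr_ge0.
move=> a b; apply: le_trans (enorm_le_normr _) _.
rewrite -mulrA ler_wpM2l //; apply: mean_value_bound => [z|z]; first exact: (dh tt).
move: (a - b) => d; have {1}-> : d = (d.1, 0) + (0, d.2).
  by case: d => x y; rewrite -[RHS]/(x + 0, 0 + y) addr0 add0r.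
rewrite linearD mulrDl; apply: le_trans (ler_normD _ _) (lerD _ _).
  rewrite pair0lE; apply: le_trans (hL1 tt z _) _; rewrite ler_wpM2l //.
  exact: le_trans (normr_le_enorm _) (enorm_fst_le d).
apply: le_trans (hL2 tt z _) _; rewrite ler_wpM2l //.
exact: le_trans (normr_le_enorm _) (enorm_snd_le d).
Qed.

End ProductLipschitz.

Section Drift.
Context {R : realType} {I : Type} {nx ny : nat}.
Local Notation X := 'rV[R]_nx.
Local Notation Y := 'rV[R]_ny.
Variable f : X * Y -> X.

(** The time derivative of [u] along the reduced equation closed by [u]; times [eps], it is the
    right-hand side of the recursion for [Gamma]. *)
Definition drift (u : X -> Y) (x : X) : Y := 'd u x (f (x, u x)).

Lemma diff_rowE (W : normedModType R) (u : X -> W) x d : differentiable u x ->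
  'd u x d = \sum_(l < nx) d 0 l *: 'D_(delta_mx 0 l) u x.
Proof. by move=> du; rewrite {1}(row_sum_delta d) diff_lincomb. Qed.

Lemma diff_sub_rowE (W : normedModType R) (u w : X -> W) x d :
  differentiable u x -> differentiable w x -> 'd u x d - 'd w x d =
    \sum_(l < nx) d 0 l *: 'D_(delta_mx 0 l) (fun y => u y - w y) x.
Proof.
move=> du dw; have duw := differentiableB du dw.
transitivity ('D_d (fun y => u y - w y) x); last first.
  by rewrite deriveE //; exact: diff_rowE.
rewrite deriveB; [|exact: diff_derivable..].
by rewrite (deriveE _ du) (deriveE _ dw).
Qed.

Lemma driftE (u : X -> Y) x : differentiable u x ->
  drift u x = \sum_(l < nx) f (x, u x) 0 l *: 'D_(delta_mx 0 l) u x.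
Proof. exact: diff_rowE. Qed.

Lemma unif_O_drift m (u : I -> X -> Y) :
  unif_O m (fun=> 1) (fun _ : I => f) -> unif_grad m.+1 u ->
  unif_O m (fun=> 1) (fun i => drift (u i)).
Proof.
move=> Hf Hu; have [du Du] := Hu.
have -> : (fun i => drift (u i)) = fun i x =>
    \sum_(l < nx) f (x, u i x) 0 l *: 'D_(delta_mx 0 l) (u i) x.
  by apply/funext => i; apply/funext => x; exact: driftE.
apply: unif_O_sum => // l; apply: unif_OZ1l; last exact: Du.
exact: unif_O_coord (unif_O_graph Hf (unif_grad_lt Hu)).
Qed.

Lemma unif_O_drift_sub m delta (u w : I -> X -> Y) : (forall i, 0 <= delta i) ->
  unif_O m.+1 (fun=> 1) (fun _ : I => f) ->
  unif_grad m.+1 u -> unif_grad m.+1 w ->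
  unif_O m.+1 delta (fun i x => u i x - w i x) ->
  unif_O m delta (fun i x => drift (u i) x - drift (w i) x).
Proof.
move=> d0 Hf Hu Hw Huw; have [du Du] := Hu; have [dw Dw] := Hw.
have -> : (fun i x => drift (u i) x - drift (w i) x) = fun i x =>
    \sum_(l < nx) (f (x, u i x) 0 l *:
        'D_(delta_mx 0 l) (fun x => u i x - w i x) x +
      (f (x, u i x) - f (x, w i x)) 0 l *: 'D_(delta_mx 0 l) (w i) x).
  apply/funext => i; apply/funext => x.
  rewrite (driftE (du i x)) (driftE (dw i x)) -sumrB.
  apply: eq_bigr => l _.
  rewrite deriveB; [|exact: diff_derivable..].
  by rewrite !mxE scalerBr scalerBl addrA subrK.
apply: unif_O_sum => // l; apply: unif_OD.
  apply: unif_OZ1l; last by have [_ [_ Duw]] := Huw; exact: Duw.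
  exact: unif_O_coord (unif_O_graph (unif_O_lt Hf) (unif_grad_lt Hu)).
apply: unif_OZ1r; last exact: Dw.
apply: unif_O_coord; apply: (unif_O_graph_sub d0 Hf (unif_grad_lt Hu)
  (unif_grad_lt Hw)); exact: unif_O_lt Huw.
Qed.

End Drift.

(** * Uniform estimates for the correction maps *)

Section Correction.
Context {R : realType} {nx ny K : nat}.
Local Notation X := 'rV[R]_nx.
Local Notation Y := 'rV[R]_ny.
Variables (f : X * Y -> X) (g : X * Y -> Y) (beta eps0 : R).
Hypothesis K_gt0 : (0 < K)%N.
Hypothesis eps0_lt1 : eps0 < 1.
Hypothesis fg_regular : regularity K f g.
Hypothesis beta_gt0 : 0 < beta.
Hypothesis g_dissipative : rapid_dissipation g beta.

(** With this index type, membership in a class means bounds uniform over all admissible [eps]. *)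
Local Notation I := {e : R | 0 < e <= eps0}.

Let f_class : unif_O K (fun=> 1) (fun _ : I => f).
Proof. by case: fg_regular => -[df _] bf _ _; exact: unif_O_of_Winfty df bf. Qed.

Let g_class : unif_grad K.+1 (fun _ : I => g).
Proof. by case: fg_regular => _ _ sg bg; exact: unif_grad_of_Winfty sg bg. Qed.

Let eps_gt0 (i : I) : 0 < sval i. Proof. by case: i => e /= /andP[]. Qed.

Let eps_le1 (i : I) : sval i <= 1.
Proof. by case: i => e /= /andP[_ /le_trans]; apply; exact: ltW. Qed.

Lemma regularity_lipschitz : exists2 L : R, 0 <= L & forall a b,
  enorm (f a - f b) <= L * enorm2 (a - b) /\
  enorm (g a - g b) <= L * enorm2 (a - b).
Proof.
have [[df _] bf sg bg] := fg_regular.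
have Hf := unif_O_le K_gt0 (unif_O_of_Winfty unit df bf).
have Hg := unif_grad_le (ltn0Sn K) (unif_grad_of_Winfty unit sg bg).
have [L1 L10 fL] := enorm_lipschitz (unif_grad_of_O Hf).
have [L2 L20 gL] := enorm_lipschitz Hg.
exists (L1 + L2) => [|a b]; first exact: addr_ge0.
split; [apply: le_trans (fL a b) _|apply: le_trans (gL a b) _];
  by rewrite ler_wpM2r ?enorm2_ge0 // ?lerDl ?lerDr.
Qed.

Lemma solve_yP x w : g (x, solve_y g x w) = w.
Proof.
have [L L0 fgL] := regularity_lipschitz.
have [] := @dissipative_surjective _ _ (fun y => g (x, y)) beta L w beta_gt0.
- by move=> y y'; exact: g_dissipative.
- move=> y y'; have [_] := fgL (x, y) (x, y'); move=> /le_trans; apply.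
  rewrite ler_wpM2l //; have -> : (x, y) - (x, y') = (0, y - y').
    by rewrite -[LHS]/(x - x, y - y') subrr.
  by apply: le_trans (enorm2_le _) _; rewrite enorm0 add0r.
(* Existence rules out the default value of [xget]. *)
by move=> y gy; apply: (@xgetPex _ 0 [set y | g (x, y) = w]); exists y.
Qed.

Let G (k : nat) (i : I) : X -> Y := Gamma f g k (sval i).

Let g_G0 i x : g (x, G 0 i x) = 0.
Proof. exact: solve_yP. Qed.

Let g_GS k i x : g (x, G k.+1 i x) = sval i *: drift f (G k i) x.
Proof. exact: solve_yP. Qed.

Let unif_O_eps (V W : normedModType R) m (delta : I -> R) (u : I -> V -> W) :
  unif_O m delta u ->
  unif_O m (fun i => sval i * delta i) (fun i x => sval i *: u i x).
Proof.
apply: unif_OZ; apply: unif_O_cst; last by move=> i; exact: ltW.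
by exists 1 => i; rewrite gtr0_norm // mul1r.
Qed.

(** [Gamma_0] inherits all [K.+1] orders of the gradient class from [g]; every further correction
    contains a derivative of its predecessor and loses one order. *)
Lemma unif_grad_Gamma k m : (k + m <= K.+1)%N -> unif_grad m (G k).
Proof.
elim: k m => [|k IH] m kmK.
  apply: (@unif_grad_implicit _ _ _ _ beta beta_gt0 (fun=> g) (fun=> g_dissipative) _ _
    (fun _ _ => 0)) => //.
  - exact: (unif_grad_le (kmK : (m <= K.+1)%N) g_class).
  - by apply: unif_grad_of_O; exact: unif_O0.
case: m kmK => // m kmK.
have mK : (m.+1 <= K)%N by rewrite -ltnS (leq_trans _ kmK) // addSn ltnS leq_addl.
apply: (@unif_grad_implicit _ _ _ _ beta beta_gt0 (fun=> g) (fun=> g_dissipative) _ _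
    (fun i x => sval i *: drift f (G k i) x)) => //.
- by apply: unif_grad_le g_class; exact: leqW.
- apply: unif_grad_of_O.
  (* Here [eps <= 1] absorbs the factor [eps], keeping the bounds uniform. *)
  apply: (@unif_O_gauge _ _ _ _ _ (fun i => sval i * 1) _ 1).
    by move=> i; rewrite !mulr1 eps_le1 ltW.
  apply: unif_O_eps; apply: unif_O_drift; first exact: unif_O_le mK f_class.
  by apply: IH; rewrite addnS -addSn.
Qed.

Lemma unif_O_Gamma_sub k m : (k + m <= K)%N ->
  unif_O m (fun i => sval i ^+ k.+1) (fun i x => G k.+1 i x - G k i x).
Proof.
have e0 p (i : I) : 0 <= sval i ^+ p by rewrite exprn_ge0 // ltW.
elim: k m => [|k IH] m kmK.
  apply: (@unif_O_implicit_sub _ _ _ _ beta beta_gt0 (fun=> g)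
    (fun=> g_dissipative)) => //.
  - by apply: unif_grad_le g_class; rewrite ltnS.
  - by apply: unif_grad_Gamma.
  - by apply: unif_grad_Gamma; exact: leqW.
  have -> : (fun i x => g (x, G 1 i x) - g (x, G 0 i x)) =
      fun i x => sval i *: drift f (G 0 i) x.
    by apply/funext => i; apply/funext => x; rewrite g_GS g_G0 subr0.
  have -> : (fun i : I => sval i ^+ 1) = (fun i : I => sval i * 1).
    by apply/funext => i; rewrite expr1 mulr1.
  apply: unif_O_eps; apply: unif_O_drift; first exact: unif_O_le kmK f_class.
  exact: unif_grad_Gamma.
have mK : (m.+1 <= K)%N by apply: leq_trans kmK; rewrite addSn ltnS leq_addl.
apply: (@unif_O_implicit_sub _ _ _ _ beta beta_gt0 (fun=> g)
    (fun=> g_dissipative)) => //.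
- by apply: unif_grad_le g_class; exact: leqW.
- by apply: unif_grad_Gamma; rewrite addSn ltnS.
- by apply: unif_grad_Gamma; exact: leqW.
have -> : (fun i x => g (x, G k.+2 i x) - g (x, G k.+1 i x)) =
    fun i x => sval i *: (drift f (G k.+1 i) x - drift f (G k i) x).
  by apply/funext => i; apply/funext => x; rewrite !g_GS scalerBr.
have -> : (fun i : I => sval i ^+ k.+2) = (fun i : I => sval i * sval i ^+ k.+1).
  by apply/funext => i; rewrite exprS.
apply: unif_O_eps; apply: unif_O_drift_sub => //.
- exact: unif_O_le mK f_class.
- by apply: unif_grad_Gamma; rewrite addnS ltnS.
- by apply: unif_grad_Gamma; rewrite addnS -addSn leqW.
- by apply: IH; rewrite addnS -addSn.
Qed.

Variable k : nat.
Hypothesis k_lt_K : (k < K)%N.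

Let Gamma_differentiable p i x : (p <= k.+1)%N -> differentiable (G p i) x.
Proof.
move=> pk; have [|//] := @unif_grad_Gamma p 1 _.
by rewrite addn1 ltnS (leq_trans pk).
Qed.

(** Besides the slow defect, this controls the initial discrepancy: the data are close to [Gamma_k],
    while the lifted curve starts on [Gamma_(k+1)]. *)
Lemma Gamma_gap : exists2 M : R, 0 <= M & forall i x,
  enorm (G k.+1 i x - G k i x) <= M * sval i ^+ k.+1.
Proof.
have [|M GM] := unif_O_bound (@unif_O_Gamma_sub k 0 _); first by rewrite addn0 ltnW.
exists (ny%:R * `|M|) => // i x; apply: le_trans (enorm_le_normr _) _.
rewrite -mulrA ler_wpM2l //; apply: le_trans (GM i x) _.
by rewrite ler_wpM2r ?ler_norm // exprn_ge0 // ltW.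
Qed.

(* Lifting the reduced equation by [Gamma k.+1], and not by [Gamma k], makes the
   defect in the stiff component [O(eps ^+ k.+1)] in spite of the factor
   [eps^-1]. *)
Lemma lifted_defect : exists2 C : R, 0 <= C & forall i x,
  enorm2 ((f (x, G k i x), 'd (G k.+1 i) x (f (x, G k i x))) -
    full_field f g (sval i) (x, G k.+1 i x)) <= C * sval i ^+ k.+1.
Proof.
have [M M0 GM] := Gamma_gap.
have [L L0 fgL] := regularity_lipschitz.
have d0 (i : I) : 0 <= sval i ^+ k.+1 by rewrite exprn_ge0 // ltW.
have HD : unif_O 0 (fun i => sval i ^+ k.+1) (fun i x =>
    \sum_(l < nx) f (x, G k i x) 0 l *:
       'D_(delta_mx 0 l) (fun x => G k.+1 i x - G k i x) x).
  apply: unif_O_sum => // l; apply: unif_OZ1l.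
    apply: unif_O_coord; apply: (@unif_O_graph _ _ _ _ _ _ (fun=> f) (G k)) => //.
    exact: unif_O_le f_class.
  (* The fast defect contains one derivative of the gap, which requires [k + 1 <= K], exactly the
     assumption on [k]. *)
  have [|_ [_ DG]] := @unif_O_Gamma_sub k 1 _; first by rewrite addn1.
  exact: DG.
have [N HN] := unif_O_bound HD.
exists (L * M + ny%:R * `|N|) => [|i x]; first by rewrite addr_ge0 ?mulr_ge0.
apply: le_trans (enorm2_le _) _; rewrite mulrDl; apply: lerD => /=.
  have [h _] := fgL (x, G k i x) (x, G k.+1 i x).
  apply: le_trans h _; rewrite -mulrA ler_wpM2l //.
  have -> : (x, G k i x) - (x, G k.+1 i x) = - (0, G k.+1 i x - G k i x).
    by rewrite -[LHS]/(x - x, _ - _) -[RHS]/(- 0, - _) subrr oppr0 opprB.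
  rewrite enorm2N; apply: le_trans (enorm2_le _) _; rewrite enorm0 add0r.
  exact: GM.
rewrite g_GS scalerA mulVf ?gt_eqF // scale1r /drift.
have -> : 'd (G k.+1 i) x (f (x, G k i x)) - 'd (G k i) x (f (x, G k i x)) =
    \sum_(l < nx) f (x, G k i x) 0 l *:
       'D_(delta_mx 0 l) (fun x => G k.+1 i x - G k i x) x.
  by apply: diff_sub_rowE; exact: Gamma_differentiable.
apply: le_trans (enorm_le_normr _) _; rewrite -mulrA ler_wpM2l //.
apply: le_trans (HN i x) _; rewrite ler_wpM2r ?ler_norm //.
Qed.

Lemma lifted_approx_solution : exists2 C : R, 0 <= C &
  forall (i : I) (xi : X) (z : R -> X),
    is_solution (correction_field f g k (sval i)) xi z ->
    approx_solution (full_field f g (sval i)) (C * sval i ^+ k.+1)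
      (fun t => (z t, G k.+1 i (z t))).
Proof.
have [C C0 defect] := lifted_defect; exists C => // i xi z [_ zc zd].
have dG x := Gamma_differentiable i x (leqnn k.+1).
have dgr x : differentiable (fun x => (x, G k.+1 i x)) x.
  by apply: differentiable_pair.
split.
  apply: (@continuous_cvg _ _ _ _ _ z (fun x => (x, G k.+1 i x))) => //.
  exact: differentiable_continuous.
move=> t t0.
exists (f (z t, G k i (z t)), 'd (G k.+1 i) (z t) (f (z t, G k i (z t)))).
  have := is_derive_comp_curve (zd t t0) (dgr (z t)).
  by rewrite diff_pair // diff_val.
exact: defect.
Qed.

(** This constant grows like [e^-1]. It serves uniqueness and the choice of the step in [fan], and
    does not enter the final bound. *)
Lemma full_field_lipschitz (e : R) : 0 < e -> exists2 L : R, 0 <= L &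
  forall a b, enorm2 (full_field f g e a - full_field f g e b) <=
    L * enorm2 (a - b).
Proof.
move=> e0; have [L L0 fgL] := regularity_lipschitz.
have ei0 : 0 <= e^-1 by rewrite invr_ge0 ltW.
exists (L + e^-1 * L) => [|a b]; first by rewrite addr_ge0 ?mulr_ge0.
apply: le_trans (enorm2_le _) _; rewrite mulrDl.
have [fL gL] := fgL a b; apply: lerD => //=.
by rewrite -scalerBr enormZ ger0_norm // -mulrA ler_wpM2l.
Qed.

End Correction.

(** * The error estimate *)

Theorem theorem3p1 (R : realType) (nx ny K k : nat)
    (f : 'rV[R]_nx * 'rV[R]_ny -> 'rV[R]_nx)
    (g : 'rV[R]_nx * 'rV[R]_ny -> 'rV[R]_ny)
    (beta eps0 : R)
    (Phi : R -> R -> 'rV[R]_nx * 'rV[R]_ny -> 'rV[R]_nx * 'rV[R]_ny)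
    (x0 : R -> 'rV[R]_nx) (y0 : R -> 'rV[R]_ny)
    (x : R -> R -> 'rV[R]_nx) (y : R -> R -> 'rV[R]_ny)
    (Xk : R -> R -> 'rV[R]_nx) :
  (0 < K)%N -> (k <= K - 1)%N ->
  0 < eps0 < 1 ->
  regularity K f g ->
  0 < beta -> rapid_dissipation g beta ->
  (forall eps : R, 0 < eps <= eps0 ->
     is_flow_map (full_field f g eps) (Phi eps)) ->
  (forall eps : R, 0 < eps <= eps0 ->
     is_solution (full_field f g eps) (x0 eps, y0 eps)
       (fun t => (x eps t, y eps t))) ->
  (forall eps : R, 0 < eps <= eps0 ->
     is_solution (correction_field f g k eps) (x eps 0) (Xk eps)) ->
  (exists M : R, forall eps : R, 0 < eps <= eps0 ->
     enorm (y eps 0 - Gamma f g k eps (x eps 0)) <= M * eps ^+ k.+1) ->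
  exists C : R, 0 < C /\
    forall (A : R) (T : R -> \bar R), 0 < A ->
      long_time_stability eps0 Phi A T ->
      forall eps t : R, 0 < eps <= eps0 -> 0 <= t -> (t%:E <= T eps)%E ->
        enorm (x eps t - Xk eps t) <= C * A * eps ^+ k.+1 * (t + 1).
Proof.
move=> K0 kK /andP[eps0_gt0 eps0_lt1] fg_reg beta0 g_diss Phi_flow xy_sol Xk_sol
  [M y0_near].
have k_lt_K : (k < K)%N by rewrite -(prednK K0) ltnS -subn1.
have [M1 M10 gap] := Gamma_gap K0 eps0_lt1 fg_reg beta0 g_diss k_lt_K.
have [C1 C10 lifted] :=
  lifted_approx_solution K0 eps0_lt1 fg_reg beta0 g_diss k_lt_K.
have C20 : 0 <= `|M| + M1 by rewrite addr_ge0.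
have C30 : 0 <= expR 1 * C1 by rewrite mulr_ge0 // expR_ge0.
(* [|M| + M1] accounts for the initial discrepancy, [expR 1 * C1] for the accumulated defects, and 1
   for positivity. All are fixed before [A] and [T] are introduced. *)
pose C := `|M| + M1 + expR 1 * C1 + 1.
exists C; split; first by rewrite /C ltr_wpDl // addr_ge0.
move=> A T A0 stable eps t eps_in t0 tT.
pose i : {e : R | 0 < e <= eps0} := exist _ eps eps_in.
have /andP[eps_gt0 _] := eps_in.
have p0 : 0 <= eps ^+ k.+1 by rewrite exprn_ge0 // ltW.
have Phi_lip s a b : 0 <= s <= t ->
    enorm2 (Phi eps s a - Phi eps s b) <= A * enorm2 (a - b).
  move=> /andP[s0 st].
  have sT : (s%:E <= T eps)%E by apply: le_trans tT; rewrite lee_fin.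
  apply: enorm2_mean_value => z; first by have [] := stable _ _ eps_in s0 sT z.
  by have [] := stable _ _ eps_in s0 sT z.
have [L L0 FL] := full_field_lipschitz K0 fg_reg eps_gt0.
have Wa := lifted i _ _ (Xk_sol eps eps_in).
pose W s := (Xk eps s, Gamma f g k.+1 eps (Xk eps s)).
have fanW : enorm2 (W t - Phi eps t (W 0)) <=
    A * (expR 1 * (C1 * eps ^+ k.+1) * t).
  exact: (fan L0 FL (Phi_flow _ eps_in) (ltW A0) (mulr_ge0 C10 p0) t0 Wa Phi_lip).
have zE : (x eps t, y eps t) = Phi eps t (x eps 0, y eps 0).
  have za := approx_solution0 (xy_sol _ eps_in).
  exact: (exact_solution_flow L0 FL (Phi_flow _ eps_in) za).
have X0 : Xk eps 0 = x eps 0 by have [] := Xk_sol _ eps_in.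
have init : enorm2 ((x eps 0, y eps 0) - W 0) <= (`|M| + M1) * eps ^+ k.+1.
  rewrite /W X0; apply: le_trans (enorm2_le _) _ => /=.
  rewrite subrr enorm0 add0r mulrDl.
  rewrite -(subrKA (Gamma f g k eps (x eps 0))).
  apply: le_trans (enormD _ _) (lerD _ _).
    by apply: le_trans (y0_near _ eps_in) _; rewrite ler_wpM2r // ler_norm.
  by rewrite -enormN opprB; exact: (gap i).
have h1 : enorm (x eps t - Xk eps t) <= enorm2 ((x eps t, y eps t) - W t).
  exact: (enorm_fst_le ((x eps t, y eps t) - W t)).
(* The comparison passes through the exact solution started at [W 0]: stability of the flow bounds
   the first difference by the initial discrepancy, and [fanW] bounds the second. *)
apply: le_trans h1 _; rewrite zE -(subrKA (Phi eps t (W 0))).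
apply: le_trans (enorm2D _ _) _.
rewrite -(enorm2N (_ - W t)) opprB.
apply: le_trans (lerD (Phi_lip _ _ _ _) fanW) _; first by rewrite t0 lexx.
apply: le_trans (lerD (ler_wpM2l (ltW A0) init) (lexx _)) _.
have -> : A * ((`|M| + M1) * eps ^+ k.+1) + A * (expR 1 * (C1 * eps ^+ k.+1) * t)
   = A * eps ^+ k.+1 * ((`|M| + M1) + expR 1 * C1 * t) by ring.
have -> : C * A * eps ^+ k.+1 * (t + 1) = A * eps ^+ k.+1 * (C * (t + 1)) by ring.
rewrite ler_wpM2l ?mulr_ge0 ?(ltW A0) // /C.
move: (`|M| + M1) (expR 1 * C1) C20 C30 => a b a0 b0; nra.
Qed.
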